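(* Let $m\ge1$, $0<q<1$, and let $\mathscr H_q^{(m)}$ be the $q$-Fock space with reproducing kernel $K_q$. The closed subspaces $\mathcal K_z=\ker\mathcal D_q$ and $\mathcal K_w=\ker\mathcal D_q^\dagger$ of $\mathscr H_q^{(m)}$ have reproducing kernels $$K_{q,z}(x,y)=\Pi_z^{(x)}K_q(x,y),\qquad K_{q,w}(x,y)=\Pi_w^{(x)}K_q(x,y),$$ where $x=(z,w)$ and the projector acts in the first variable. The strong operator limit $$P_{q,\mathrm{mon}}=\operatorname*{s-lim}_{k\to\infty}(\Pi_z\Pi_w)^k$$ exists and is the orthogonal projection onto $\mathcal M_q=\ker\mathcal D_q\cap\ker\mathcal D_q^\dagger$, and $$K_{q,\mathrm{mon}}(x,y)=P_{q,\mathrm{mon}}^{(x)}K_q(x,y)$$ is the reproducing kernel of $\mathcal M_q$.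
   Context: $[r]_q=\frac{1-q^r}{1-q}$, $[r]_q!=\prod_{k=1}^r[k]_q$, $[\alpha]_q!=\prod_i[\alpha_i]_q!$, $\mathrm e_q(t)=\sum_{r\ge0}t^r/[r]_q!$. $\mathscr P_m=\mathbb C[z_1,\dots,z_m,w_1,\dots,w_m]\otimes\bigwedge\mathbb C^m$ with basis $z^\alpha w^\beta e_S$ ($\alpha,\beta\in\mathbb N_0^m$, $S\subseteq\{1,\dots,m\}$); $\mathscr H_q^{(m)}$ is its Hilbert completion for the Jackson–Fischer inner product, which makes this basis orthogonal with $\|z^\alpha w^\beta e_S\|^2=[\alpha]_q!\,[\beta]_q!$. It is a space of holomorphic $\bigwedge\mathbb C^m$-valued functions on $\Omega_q=\{(z,w)\in\mathbb C^{2m}:|z_i|,|w_i|<(1-q)^{-1/2}\ \forall i\}$ with reproducing kernel $K_q((z,w),(\zeta,\omega))=\prod_{i=1}^m\mathrm e_q(z_i\overline{\zeta_i})\mathrm e_q(w_i\overline{\omega_i})\,I$, meaning $\langle f,K_q(\cdot,y)v\rangle=\langle f(y),v\rangle$ (inner products linear in the first argument). For a bounded operator $P$ on $\mathscr H_q^{(m)}$, $P^{(x)}K_q(x,y)$ is defined by $(P^{(x)}K_q(x,y))v=(P[K_q(\cdot,y)v])(x)$. $D_{q,x}f=\frac{f(\dots,qx,\dots)-f(\dots,x,\dots)}{(q-1)x}$; $\varepsilon_i$ is exterior multiplication by the $i$-th basis vector, $\iota_i=\varepsilon_i^*$ contraction. $\mathcal D_q=\sum_i\varepsilon_iD_{q,z_i}$,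 $\mathcal D_q^\dagger=\sum_i\iota_iD_{q,w_i}$, $\mathcal Z=\sum_i\iota_iz_i$, $\mathcal Z^\dagger=\sum_i\varepsilon_iw_i$. $A_q=\mathcal D_q\mathcal Z+\mathcal Z\mathcal D_q$ and $B_q=\mathcal D_q^\dagger\mathcal Z^\dagger+\mathcal Z^\dagger\mathcal D_q^\dagger$ are diagonal in the basis with eigenvalues $\sum_i[\alpha_i+\mathbf 1_{i\in S}]_q$ and $\sum_i[\beta_i+1-\mathbf 1_{i\in S}]_q$; $A_q^\#,B_q^\#$ invert the positive eigenvalues and keep eigenvalue zero as zero. $\Pi_z=I-\mathcal ZA_q^\#\mathcal D_q$, $\Pi_w=I-\mathcal Z^\dagger B_q^\#\mathcal D_q^\dagger$. All these operators extend boundedly to $\mathscr H_q^{(m)}$. *)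

(* Defs.v *)
From HB Require Import structures.
From mathcomp Require Import all_boot all_order all_algebra.
From mathcomp Require Import all_classical all_reals all_analysis.
From mathcomp Require Import complex.
From mathcomp Require Import ring.

Set Implicit Arguments.
Unset Strict Implicit.
Unset Printing Implicit Defensive.

Import Order.TTheory GRing.Theory Num.Theory.
Import numFieldNormedType.Exports.

Local Open Scope classical_set_scope.
Local Open Scope ring_scope.
Local Open Scope complex_scope.

(* Sums of absolutely convergent families indexed by an arbitrary type; on a
   family that is not absolutely convergent the value is meaningless. *)
Definition rsum (R : realType) (I : choiceType) (u : I -> R) : R :=
  fine (\esum_(i in [set: I]) (Num.max (u i) 0)%:E)
  - fine (\esum_(i in [set: I]) (Num.max (- u i) 0)%:E).

Definition csum (R : realType) (I : choiceType) (u : I -> R[i]) : R[i] :=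
  rsum (fun i => complex.Re (u i)) +i* rsum (fun i => complex.Im (u i)).

Definition qint (R : realType) (q : R) (r : nat) : R := (1 - q ^+ r) / (1 - q).

Definition qfact (R : realType) (q : R) (r : nat) : R :=
  \prod_(1 <= k < r.+1) qint q k.

(* Only used for [|t| < 1 / (1 - q)], where the series converges absolutely. *)
Definition qexp (R : realType) (q : R) (t : R[i]) : R[i] :=
  csum (fun r : nat => t ^+ r / (qfact q r)%:C).

(* The 2m variables: [inl i] stands for z_i and [inr i] for w_i. *)
Definition var (m : nat) : finType := ('I_m + 'I_m)%type.

(* The monomial z^alpha w^beta is encoded by g with alpha_i = g (inl i) and
   beta_i = g (inr i). *)
Definition mono (m : nat) : choiceType := {ffun var m -> nat}.

Definition cpoint (R : realType) (m : nat) := var m -> R[i].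

(* The exterior algebra of C^m: [v S] is the coefficient of
   e_S = e_{s_1} /\ ... /\ e_{s_p}, where S = {s_1 < ... < s_p}. *)
Definition ext (R : realType) (m : nat) : lmodType R[i] :=
  ({set 'I_m} -> R[i]^o).

(* Formal power series in z, w with values in the exterior algebra; [f g S] is
   the coefficient of z^alpha w^beta e_S. The polynomials are the f with finite
   support. Each coefficient of D f, Z f, etc. involves finitely many coefficients
   of f, so these operators make sense on all formal series; on H_q they are the
   bounded extensions of their restrictions to polynomials. *)
Definition fseries (R : realType) (m : nat) : lmodType R[i] := (mono m -> ext R m).

Section QFock.
Context (R : realType) (m : nat) (q : R).
Implicit Types (i j : 'I_m) (S : {set 'I_m}) (k : var m) (g : mono m).
Implicit Types (v : ext R m) (f h : fseries R m) (x y : cpoint R m).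

(* e_i /\ e_S = wedge_sign i S * e_(i |: S) for i \notin S *)
Definition wedge_sign i S : R[i] := (-1) ^+ #|[set j in S | (j < i)%N]|.

Definition ext_mul i v : ext R m :=
  fun S => if i \in S then wedge_sign i (S :\ i) * v (S :\ i) else 0.

Definition ext_contract i v : ext R m :=
  fun S => if i \in S then 0 else wedge_sign i S * v (i |: S).

Definition ext_ip (u v : ext R m) : R[i] := \sum_S u S * (v S)^*.

Lemma ext_contract_adjoint i (u v : ext R m) :
  ext_ip (ext_mul i u) v = ext_ip u (ext_contract i v).
Proof.
rewrite /ext_ip (bigID (fun S => i \in S)) /= [RHS](bigID (fun S => i \in S)) /=.
rewrite [X in _ + X]big1 ?addr0; last first.
  by move=> S iS; rewrite /ext_mul (negbTE iS) mul0r.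
rewrite [X in _ = X + _]big1 ?add0r; last first.
  by move=> S iS; rewrite /ext_contract iS rmorph0 mulr0.
rewrite (reindex_onto (fun S => i |: S) (fun S => S :\ i)) /=; last first.
  by move=> S iS; rewrite finset.setD1K.
apply: eq_big => [S|S].
  rewrite finset.setU11 /=; apply/eqP/idP => [<-|iS]; first by rewrite !inE eqxx.
  by rewrite finset.setU1K.
rewrite finset.setU11 /= => /eqP iS.
have {}iS : i \notin S by rewrite -iS !inE eqxx.
rewrite /ext_mul /ext_contract finset.setU11 (negbTE iS) finset.setU1K //.
rewrite rmorphM /= /wedge_sign rmorphXn rmorphN rmorph1.
by rewrite mulrAC mulrC mulrA.
Qed.

Definition mono_up k g : mono m := [ffun l => (g l + (l == k))%N].
Definition mono_down k g : mono m := [ffun l => (g l - (l == k))%N].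

(* f(.., q x_k, ..) *)
Definition dilate k f : fseries R m := fun g => (q%:C ^+ g k) *: f g.

(* x_k f *)
Definition mulvar k f : fseries R m :=
  fun g => if g k == 0%N then 0 else f (mono_down k g).

(* f / x_k, for f without terms of degree 0 in x_k *)
Definition divvar k f : fseries R m := fun g => f (mono_up k g).

Lemma mulvarK k : cancel (mulvar k) (divvar k).
Proof.
move=> f; apply/funext => g; rewrite /divvar /mulvar ffunE eqxx addn1 /=.
by congr f; apply/ffunP => l; rewrite !ffunE addnK.
Qed.

(* The q-difference quotient (f(.., q x_k, ..) - f) / ((q - 1) x_k). *)
Definition qdiff k f : fseries R m :=
  divvar k ((q - 1)%:C^-1 *: (dilate k f - f)).

Lemma qdiffP k f :
  q != 1 -> (q - 1)%:C *: mulvar k (qdiff k f) = dilate k f - f.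
Proof.
move=> q1; apply/funext => g.
have cE (c : R[i]) (u : fseries R m) g' : (c *: u) g' = c *: u g' by [].
have dE (u u' : fseries R m) g' : (u - u') g' = u g' - u' g' by [].
rewrite cE /mulvar /qdiff /divvar; case: eqP => [gk|/eqP gk].
  by rewrite scaler0 dE /dilate gk expr0 scale1r subrr.
have -> : mono_up k (mono_down k g) = g.
  apply/ffunP => l; rewrite !ffunE; case: eqP => [->|]; last by rewrite subn0 addn0.
  by rewrite subnK // lt0n.
rewrite cE scalerA divff ?scale1r // /real_complex_def eq_complex /= eqxx andbT.
by rewrite subr_eq0.
Qed.

Definition mulE i f : fseries R m := fun g => ext_mul i (f g).
Definition contractE i f : fseries R m := fun g => ext_contract i (f g).

Definition Dop f : fseries R m := \sum_(i < m) mulE i (qdiff (inl i) f).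
Definition Ddag f : fseries R m := \sum_(i < m) contractE i (qdiff (inr i) f).
Definition Zop f : fseries R m := \sum_(i < m) contractE i (mulvar (inl i) f).
Definition Zdag f : fseries R m := \sum_(i < m) mulE i (mulvar (inr i) f).

Definition Aop f : fseries R m := Dop (Zop f) + Zop (Dop f).
Definition Bop f : fseries R m := Ddag (Zdag f) + Zdag (Ddag f).

Definition basis g S : fseries R m :=
  fun g' S' => ((g' == g) && (S' == S))%:R.

(* For T diagonal in the basis z^alpha w^beta e_S: invert the nonzero
   eigenvalues and keep the zero ones (in R[i], 0^-1 = 0). *)
Definition diag_pinv (T : fseries R m -> fseries R m) f : fseries R m :=
  fun g S => (T (basis g S) g S)^-1 * f g S.

Definition Asharp : fseries R m -> fseries R m := diag_pinv Aop.
Definition Bsharp : fseries R m -> fseries R m := diag_pinv Bop.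

Definition Piz f : fseries R m := f - Zop (Asharp (Dop f)).
Definition Piw f : fseries R m := f - Zdag (Bsharp (Ddag f)).

(* A_q and B_q are diagonal: see AopE and BopE. *)
Lemma qdiffE k f g S : qdiff k f g S = (qint q (g k).+1)%:C * f (mono_up k g) S.
Proof.
rewrite /qdiff /divvar.
have -> : ((q - 1)%:C^-1 *: (dilate k f - f)) (mono_up k g) S =
  (q - 1)%:C^-1 * (q%:C ^+ (mono_up k g) k * f (mono_up k g) S - f (mono_up k g) S).
  by [].
rewrite ffunE eqxx addn1 /qint -[X in _ * (_ - X)]mul1r -mulrBl mulrA.
congr (_ * _).
rewrite -rmorphXn -(rmorph1 (real_complex R)) -rmorphB -fmorphV -rmorphM /=.
by rewrite mulrC -opprB -[in LHS](opprB 1 q) invrN mulrNN.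
Qed.

Lemma wedge_signD1 i j S : j \in S ->
  wedge_sign i S = (-1) ^+ (j < i)%N * wedge_sign i (S :\ j).
Proof.
move=> jS; rewrite /wedge_sign -exprD; congr (_ ^+ _).
case: ltnP => ji; last first.
  rewrite add0n; apply: eq_card => l; rewrite !inE.
  by case: eqVneq => [->|//]; rewrite ltnNge ji andbF.
rewrite (cardsD1 j) !inE jS ji; congr (_ + _)%N.
by apply: eq_card => l; rewrite !inE andbA.
Qed.

Lemma wedge_signK i S : wedge_sign i S * wedge_sign i S = 1.
Proof. by rewrite -expr2 sqrr_sign. Qed.

Lemma ext_anticommute i j v :
  ext_mul i (ext_contract j v) + ext_contract j (ext_mul i v) =
  if i == j then v else 0.
Proof.
apply/funext => S.
have -> : (ext_mul i (ext_contract j v) + ext_contract j (ext_mul i v)) S =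
  ext_mul i (ext_contract j v) S + ext_contract j (ext_mul i v) S by [].
rewrite /ext_mul /ext_contract !inE; case: eqVneq => [->|ij] /=.
  case: ifPn => jS; first by rewrite mulrA wedge_signK mul1r finset.setD1K ?addr0.
  by rewrite add0r mulrA finset.setU1K // wedge_signK mul1r.
have -> : (0 : ext R m) S = 0 by [].
have [jS|jS] := boolP (j \in S); first by rewrite mulr0 if_same addr0.
have [iS|iS] := boolP (i \in S); last first.
  by rewrite mulr0 addr0.
have -> : (j |: S) :\ i = j |: (S :\ i).
  by apply/setP => l; rewrite !inE; case: eqVneq => [->|]; rewrite ?(eq_sym i) ?(negbTE ij).
rewrite !mulrA -mulrDl [X in X * _](_ : _ = 0) ?mul0r //.
have -> : wedge_sign i (j |: (S :\ i)) = (-1) ^+ (j < i)%N * wedge_sign i (S :\ i).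
  rewrite (@wedge_signD1 i j) ?finset.setU11 // finset.setU1K // !inE.
  by rewrite (negbTE jS) andbF.
rewrite (wedge_signD1 j iS).
have : (j < i)%N != (i < j)%N.
  by move: ij; rewrite neq_ltn; case: (ltngtP j i).
case: (j < i)%N; case: (i < j)%N => //= _; rewrite ?expr0 ?expr1; ring.
Qed.

Lemma ext_mul_contract i v S :
  ext_mul i (ext_contract i v) S = if i \in S then v S else 0.
Proof.
rewrite /ext_mul /ext_contract !inE eqxx /=; case: ifP => // iS.
by rewrite mulrA wedge_signK mul1r finset.setD1K.
Qed.

Lemma ext_contract_mul i v S :
  ext_contract i (ext_mul i v) S = if i \in S then 0 else v S.
Proof.
rewrite /ext_mul /ext_contract finset.setU11; case: ifPn => // iS.
by rewrite finset.setU1K // mulrA wedge_signK mul1r.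
Qed.

Lemma ext_mulD i : {morph ext_mul i : u v / u + v}.
Proof.
move=> u v; apply/funext => S.
have E (u' v' : ext R m) T : (u' + v') T = u' T + v' T by [].
by rewrite E /ext_mul E; case: ifP => _; rewrite ?mulrDr ?addr0.
Qed.

Lemma ext_contractD i : {morph ext_contract i : u v / u + v}.
Proof.
move=> u v; apply/funext => S.
have E (u' v' : ext R m) T : (u' + v') T = u' T + v' T by [].
by rewrite E /ext_contract E; case: ifP => _; rewrite ?mulrDr ?addr0.
Qed.

Lemma mulvarD k : {morph mulvar k : f h / f + h}.
Proof.
move=> f h; apply/funext => g.
have E (u' v' : fseries R m) T : (u' + v') T = u' T + v' T by [].
by rewrite E /mulvar E; case: ifP => _; rewrite ?addr0.
Qed.

Lemma qdiffD k : {morph qdiff k : f h / f + h}.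
Proof.
move=> f h; apply/funext => g; apply/funext => S.
have E (u' v' : fseries R m) T U : (u' + v') T U = u' T U + v' T U by [].
by rewrite E !qdiffE E mulrDr.
Qed.

Lemma mulED i : {morph mulE i : f h / f + h}.
Proof. by move=> f h; apply/funext => g; rewrite /mulE ext_mulD. Qed.

Lemma contractED i : {morph contractE i : f h / f + h}.
Proof. by move=> f h; apply/funext => g; rewrite /contractE ext_contractD. Qed.

Lemma mulE_qdiff i k f : mulE i (qdiff k f) = qdiff k (mulE i f).
Proof.
apply/funext => g; apply/funext => S; rewrite qdiffE /mulE /ext_mul qdiffE.
by case: ifP => _; rewrite ?mulr0 // mulrCA.
Qed.

Lemma contractE_qdiff i k f : contractE i (qdiff k f) = qdiff k (contractE i f).
Proof.
apply/funext => g; apply/funext => S.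
rewrite qdiffE /contractE /ext_contract qdiffE.
by case: ifP => _; rewrite ?mulr0 // mulrCA.
Qed.

Lemma mulE_mulvar i k f : mulE i (mulvar k f) = mulvar k (mulE i f).
Proof.
apply/funext => g; apply/funext => S; rewrite /mulE /ext_mul /mulvar.
by case: (g k == 0%N) => //; rewrite (_ : (0 : ext R m) _ = 0) // mulr0 if_same.
Qed.

Lemma contractE_mulvar i k f :
  contractE i (mulvar k f) = mulvar k (contractE i f).
Proof.
apply/funext => g; apply/funext => S; rewrite /contractE /ext_contract /mulvar.
by case: (g k == 0%N) => //; rewrite (_ : (0 : ext R m) _ = 0) // mulr0 if_same.
Qed.

Lemma qdiff_mulvar k l f : k != l -> qdiff k (mulvar l f) = mulvar l (qdiff k f).
Proof.
move=> kl; apply/funext => g; apply/funext => S.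
rewrite qdiffE /mulvar ffunE [l == k]eq_sym (negbTE kl) addn0.
case: ifP => _; first by rewrite (_ : (0 : ext R m) _ = 0) // mulr0.
rewrite qdiffE ffunE (negbTE kl) subn0; congr (_ * f _ S).
apply/ffunP => j; rewrite !ffunE.
have [->|_] := eqVneq j l; last by rewrite !subn0.
by rewrite [l == k]eq_sym (negbTE kl) !addn0.
Qed.

Lemma qdiff_mulvar_diag k f g S :
  qdiff k (mulvar k f) g S = (qint q (g k).+1)%:C * f g S.
Proof.
by rewrite qdiffE -[X in _ = _ * X g S](mulvarK k).
Qed.

Lemma mulvar_qdiff_diag k f g S :
  mulvar k (qdiff k f) g S = (qint q (g k))%:C * f g S.
Proof.
rewrite /mulvar; case: eqP => [->|/eqP gk].
  by rewrite /qint expr0 subrr mul0r mul0r.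
rewrite qdiffE ffunE eqxx subn1 prednK ?lt0n //; congr (_ * f _ S).
apply/ffunP => l; rewrite !ffunE.
by case: eqP => [->|]; rewrite ?subn0 ?addn0 // subnK // lt0n.
Qed.

Lemma morph_sum (T : fseries R m -> fseries R m) (F : 'I_m -> fseries R m) :
  {morph T : f h / f + h} -> T (\sum_i F i) = \sum_i T (F i).
Proof.
move=> TD; apply: (big_morph T TD).
by apply: (addrI (T 0)); rewrite -TD !addr0.
Qed.

Lemma AopE f g S :
  Aop f g S = (\sum_i qint q (g (inl i) + (i \in S)))%:C * f g S.
Proof.
have -> : Aop f = \sum_i \sum_j
    (mulE i (contractE j (qdiff (inl i) (mulvar (inl j) f))) +
     contractE j (mulE i (mulvar (inl j) (qdiff (inl i) f)))).
  under eq_bigr do rewrite big_split /=.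
  rewrite big_split /= [X in _ + X]exchange_big /=; congr (_ + _).
    apply: eq_bigr => i _; rewrite (morph_sum _ (qdiffD _)) (morph_sum _ (mulED _)).
    by apply: eq_bigr => j _; rewrite contractE_qdiff.
  apply: eq_bigr => i _.
  rewrite (morph_sum _ (mulvarD _)) (morph_sum _ (contractED _)).
  by apply: eq_bigr => j _; rewrite mulE_mulvar.
rewrite rmorph_sum mulr_suml !fct_sumE; apply: eq_bigr => i _.
rewrite (bigD1 i) //= big1 ?addr0 => [|j ji]; last first.
  rewrite qdiff_mulvar; last by apply: contra ji => /eqP[->].
  apply/funext => g'.
  set h := mulvar _ _; transitivity (if i == j then h g' else 0).
    exact: (ext_anticommute i j (h g')).
  by rewrite eq_sym (negbTE ji).
set h1 := qdiff _ _; set h2 := mulvar _ (qdiff _ _).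
have -> : (mulE i (contractE i h1) + contractE i (mulE i h2)) g S =
  ext_mul i (ext_contract i (h1 g)) S + ext_contract i (ext_mul i (h2 g)) S by [].
rewrite /h1 /h2 ext_mul_contract ext_contract_mul qdiff_mulvar_diag mulvar_qdiff_diag.
by case: (i \in S); rewrite ?addr0 ?add0r ?addn1 ?addn0.
Qed.

Lemma BopE f g S :
  Bop f g S = (\sum_i qint q (g (inr i) + (i \notin S)))%:C * f g S.
Proof.
have -> : Bop f = \sum_i \sum_j
    (contractE i (mulE j (qdiff (inr i) (mulvar (inr j) f))) +
     mulE j (contractE i (mulvar (inr j) (qdiff (inr i) f)))).
  under eq_bigr do rewrite big_split /=.
  rewrite big_split /= [X in _ + X]exchange_big /=; congr (_ + _).
    apply: eq_bigr => i _; rewrite (morph_sum _ (qdiffD _)) (morph_sum _ (contractED _)).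
    by apply: eq_bigr => j _; rewrite mulE_qdiff.
  apply: eq_bigr => i _.
  rewrite (morph_sum _ (mulvarD _)) (morph_sum _ (mulED _)).
  by apply: eq_bigr => j _; rewrite contractE_mulvar.
rewrite rmorph_sum mulr_suml !fct_sumE; apply: eq_bigr => i _.
rewrite (bigD1 i) //= big1 ?addr0 => [|j ji]; last first.
  rewrite qdiff_mulvar; last by apply: contra ji => /eqP[->].
  apply/funext => g'.
  set h := mulvar _ _; transitivity (if j == i then h g' else 0).
    by rewrite -(ext_anticommute j i (h g')) addrC.
  by rewrite (negbTE ji).
set h1 := qdiff _ _; set h2 := mulvar _ (qdiff _ _).
have -> : (contractE i (mulE i h1) + mulE i (contractE i h2)) g S =
  ext_contract i (ext_mul i (h1 g)) S + ext_mul i (ext_contract i (h2 g)) S by [].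
rewrite /h1 /h2 ext_mul_contract ext_contract_mul qdiff_mulvar_diag mulvar_qdiff_diag.
by case: (i \in S); rewrite ?addr0 ?add0r ?addn1 ?addn0.
Qed.

(* The Hilbert space H_q: the completion of the polynomials for the
   Jackson--Fischer inner product, i.e. the series with square summable
   coefficients with respect to the weights [alpha]_q! [beta]_q!. *)
Definition weight g : R := \prod_k qfact q (g k).

Definition sqnorm f : \bar R :=
  \esum_(gS in [set: mono m * {set 'I_m}])
     (complex.Re (`|f gS.1 gS.2| ^+ 2) * weight gS.1)%:E.

Definition Hq : set (fseries R m) := [set f | (sqnorm f < +oo)%E].

Definition inner f h : R[i] :=
  csum (fun gS : mono m * {set 'I_m} =>
    f gS.1 gS.2 * (h gS.1 gS.2)^* * (weight gS.1)%:C).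

Definition hnorm f : R := Num.sqrt (complex.Re (inner f f)).

(* Elements of H_q as functions on Omega_q. *)
Definition Omega : set (cpoint R m) :=
  [set x | forall k, `|x k| < ((Num.sqrt (1 - q))^-1)%:C].

Definition fs_eval f x : ext R m :=
  fun S => csum (fun g : mono m => f g S * \prod_k x k ^+ g k).

Definition Kq x y v : ext R m := (\prod_k qexp q (x k * (y k)^*)) *: v.

(* K_q(., y) v as an element of H_q. *)
Definition Ksection y v : fseries R m :=
  xget 0 [set h | Hq h /\ forall x, Omega x -> fs_eval h x = Kq x y v].

(* P^(x) K_q(x, y) *)
Definition act_kernel (P : fseries R m -> fseries R m) x y v : ext R m :=
  fs_eval (P (Ksection y v)) x.

Definition closed_subspace (V : set (fseries R m)) : Prop :=
  [/\ V `<=` Hq, V 0,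
      forall (a : R[i]) f h, V f -> V h -> V (a *: f + h)
    & forall (u : nat -> fseries R m) f, (forall n, V (u n)) -> Hq f ->
        hnorm (u n - f) @[n --> \oo] --> (0 : R) -> V f].

Definition is_reproducing_kernel (V : set (fseries R m))
    (K : cpoint R m -> cpoint R m -> ext R m -> ext R m) : Prop :=
  (forall x y, Omega x -> Omega y -> linear (K x y)) /\
  (forall y v, Omega y -> exists h,
     [/\ V h, forall x, Omega x -> fs_eval h x = K x y v
       & forall f, V f -> inner f h = ext_ip (fs_eval f y) v]).

Definition bounded_operator (T : fseries R m -> fseries R m) : Prop :=
  [/\ forall f, Hq f -> Hq (T f),
      forall (a : R[i]) f h, Hq f -> Hq h -> T (a *: f + h) = a *: T f + T h
    & exists M : R, forall f, Hq f -> hnorm (T f) <= M * hnorm f].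

Definition strong_limit (T : nat -> fseries R m -> fseries R m)
    (P : fseries R m -> fseries R m) : Prop :=
  [/\ forall n, bounded_operator (T n), bounded_operator P
    & forall f, Hq f -> hnorm (T n f - P f) @[n --> \oo] --> (0 : R)].

Definition orthogonal_projection (V : set (fseries R m))
    (P : fseries R m -> fseries R m) : Prop :=
  closed_subspace V /\
  forall f, Hq f -> V (P f) /\ forall h, V h -> inner (f - P f) h = 0.

Definition kerD : set (fseries R m) := [set f | Hq f /\ Dop f = 0].
Definition kerDdag : set (fseries R m) := [set f | Hq f /\ Ddag f = 0].

End QFock.

Arguments kerD {R} m q.
Arguments kerDdag {R} m q.

(* Main.v *)
Require Import Defs.
From mathcomp Require Import all_boot all_order all_algebra finmap.
From mathcomp Require Import all_classical all_reals all_analysis.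
From mathcomp Require Import complex.
From mathcomp Require Import ring lra.
Import Order.TTheory GRing.Theory Num.Theory.
Import numFieldNormedType.Exports.
Local Open Scope classical_set_scope.
Local Open Scope ring_scope.
Local Open Scope complex_scope.

(* The coefficients of a series identify H_q with a weighted l^2 space, hence a
   Hilbert space, in which multiplication by a variable is adjoint to the
   corresponding q-difference quotient and exterior multiplication to contraction.
   Thus Z is the adjoint of D_q, and I - Z A^# D_q takes values in ker D_q
   (because D_q^2 = 0 and A^# commutes with D_q) while its complement
   Z A^# D_q has range orthogonal to ker D_q; so Pi_z is the orthogonal projector
   onto ker D_q, and likewise for Pi_w.  Von Neumann's alternating projection
   theorem yields the strong limit.  Finally, if P is the orthogonal projector onto
   V, then P applied to the reproducing section K_q(., y) v represents evaluation
   at y on V, by self-adjointness of P. *)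

(** * Hilbert spaces and alternating projections *)

(** The operators act on all formal series, while [inner] and evaluation are sums with a meaningless
    value outside absolute convergence. Hence the Hilbert theory is relative to a subset [H] of a
    module: identities such as $D_q^2=0$ are checked coefficientwise on formal series, and analysis
    enters only through membership in $H_q$, adjointness and completeness. Two estimates keep the
    operators inside $H_q$: $[n]_q\le(1-q)^{-1}$ bounds the multiplications and $q$-differences, and
    $[n]_q\ge1$ for $n\ge1$ bounds $A_q^\#$ and $B_q^\#$, since every nonzero eigenvalue is then at
    least 1. The product of two projections is not self-adjoint in general; convergence is therefore
    proved for $T=FEF$ and carried over to $EF$. [Ksection] is only some element of $H_q$ with
    prescribed values on [Omega]. To compute with it, explicit coefficients must be shown to have
    these values (a product of $q$-exponentials is expanded into one multi-index sum), and
    evaluation must be shown injective, which is an identity theorem for power series in several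
    variables. *)

Record hilbert {R : realType} {V : lmodType R[i]} {H : set V}
    {ip : V -> V -> R[i]} : Prop := Hilbert {
  hil0 : H 0;
  hilP : forall a f h, H f -> H h -> H (a *: f + h);
  hil_lin : forall a f h k, H f -> H h -> H k ->
    ip (a *: f + h) k = a * ip f k + ip h k;
  hilC : forall f h, H f -> H h -> ip h f = (ip f h)^*;
  hil_ge0 : forall f, H f -> 0 <= ip f f;
  hil_def : forall f, H f -> ip f f = 0 -> f = 0;
  hil_complete : forall u : nat -> V, (forall n, H (u n)) ->
    (forall e : R, 0 < e -> exists N, forall i j, (N <= i)%N -> (N <= j)%N ->
       complex.Re (ip (u i - u j) (u i - u j)) <= e) ->
    exists2 l, H l &
      complex.Re (ip (u n - l) (u n - l)) @[n --> \oo] --> (0 : R) }.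

Arguments hilbert {R V} H ip.

(** Linearity, idempotence, self-adjointness and contractivity of [P], as well as closedness of [U],
    are not part of the notion: all follow from orthogonality of the residual [f - P f] to [U]. *)
Definition orthproj {R : realType} {V : lmodType R[i]} (H : set V)
    (ip : V -> V -> R[i]) (U : set V) (P : V -> V) : Prop :=
  [/\ U `<=` H, U 0, forall (a : R[i]) f h, U f -> U h -> U (a *: f + h)
    & forall f, H f -> U (P f) /\ forall h, U h -> ip (f - P f) h = 0].

Section Hilbert.
Context {R : realType} {V : lmodType R[i]} {H : set V} {ip : V -> V -> R[i]}.
Hypothesis hH : hilbert H ip.
Implicit Types (a : R[i]) (f h k l : V) (U W : set V).

Let sqn f : R := complex.Re (ip f f).

Lemma hilD f h : H f -> H h -> H (f + h).
Proof. by move=> Hf Hh; rewrite -[f]scale1r; exact: (hilP hH). Qed.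

Lemma hilZ a f : H f -> H (a *: f).
Proof. by move=> Hf; rewrite -[_ *: _]addr0; exact: (hilP hH _ _ _ Hf (hil0 hH)). Qed.

Lemma hilB f h : H f -> H h -> H (f - h).
Proof. by move=> Hf Hh; rewrite addrC -scaleN1r; exact: (hilP hH). Qed.

Lemma ip0l h : H h -> ip 0 h = 0.
Proof.
move=> Hh; have := hil_lin hH 1 _ _ _ (hil0 hH) (hil0 hH) Hh.
by rewrite scale1r addr0 mul1r => /eqP; rewrite eq_sym -subr_eq0 addrK => /eqP.
Qed.

Lemma ipDl f h k : H f -> H h -> H k -> ip (f + h) k = ip f k + ip h k.
Proof. by move=> Hf Hh Hk; rewrite -{1}[f]scale1r (hil_lin hH)// mul1r. Qed.

Lemma ipZl a f k : H f -> H k -> ip (a *: f) k = a * ip f k.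
Proof.
move=> Hf Hk; rewrite -{1}[_ *: _]addr0 (hil_lin hH)// ?ip0l ?addr0//.
exact: (hil0 hH).
Qed.

Lemma ipBl f h k : H f -> H h -> H k -> ip (f - h) k = ip f k - ip h k.
Proof.
by move=> Hf Hh Hk; rewrite addrC -scaleN1r (hil_lin hH)// mulN1r addrC.
Qed.

Lemma ip0r h : H h -> ip h 0 = 0.
Proof. by move=> Hh; rewrite (hilC hH) ?ip0l ?rmorph0//; exact: (hil0 hH). Qed.

Lemma ipDr f h k : H f -> H h -> H k -> ip k (f + h) = ip k f + ip k h.
Proof.
move=> Hf Hh Hk; rewrite (hilC hH)//; last exact: hilD.
by rewrite ipDl// rmorphD/= -!(hilC hH).
Qed.

Lemma ipBr f h k : H f -> H h -> H k -> ip k (f - h) = ip k f - ip k h.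
Proof.
move=> Hf Hh Hk; rewrite (hilC hH)//; last exact: hilB.
by rewrite ipBl// rmorphB/= -!(hilC hH).
Qed.

Lemma ip_sqn f : H f -> ip f f = (sqn f)%:C.
Proof.
by move=> Hf; rewrite /sqn RRe_real// ger0_real// (hil_ge0 hH).
Qed.

Lemma sqn_ge0 f : H f -> 0 <= sqn f.
Proof. by move=> Hf; rewrite -ler0c -ip_sqn// (hil_ge0 hH). Qed.

Lemma sqn_eq0 f : H f -> sqn f = 0 -> f = 0.
Proof. by move=> Hf f0; apply: (hil_def hH) => //; rewrite ip_sqn// f0. Qed.

Lemma sqnB_eq f h : H f -> H h ->
  sqn (f - h) = sqn f - complex.Re (ip f h) *+ 2 + sqn h.
Proof.
move=> Hf Hh; rewrite {1}/sqn ipBl ?ipBr//; try exact: hilB.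
rewrite (hilC hH _ _ Hf Hh) /sqn.
case: (ip f f) (ip f h) (ip h h) => [a b] [c d] [x y] /=; ring.
Qed.

Lemma sqnB_le f h : H f -> H h -> sqn (f - h) <= 2 * sqn f + 2 * sqn h.
Proof.
move=> Hf Hh.
have : 0 <= sqn (f + h) by apply: sqn_ge0; exact: hilD.
rewrite sqnB_eq// {1}/sqn ipDl ?ipDr//; try exact: hilD.
rewrite (hilC hH _ _ Hf Hh) /sqn.
by case: (ip f f) (ip f h) (ip h h) => [a b] [c d] [x y] /=; lra.
Qed.

Lemma Cauchy_Schwarz f h : H f -> H h -> `|ip f h| ^+ 2 <= ip f f * ip h h.
Proof.
move=> Hf Hh; rewrite sqr_normc.
have [c0|c0] := eqVneq (ip h h) 0.
  have H0 := hil0 hH.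
  by rewrite (hil_def hH _ Hh c0) !ip0r// mulr0 mul0r.
(* [k] is the component of [f] orthogonal to [h], scaled by [ip h h] to avoid a division; expanding
   [ip k k] leaves [c] times the difference of the two sides of the inequality. *)
set c := ip h h; set z := ip f h; pose k := c *: f - z *: h.
have Hk : H k by apply: hilB; exact: hilZ.
have kf : ip k f = c * ip f f - z * z^*.
  by rewrite ipBl ?ipZl//; try exact: hilZ; rewrite (hilC hH _ _ Hf Hh).
have kh : ip k h = 0.
  by rewrite ipBl ?ipZl//; try exact: hilZ; rewrite -/c -/z mulrC subrr.
have cc : c^* = c by rewrite -(hilC hH).
have : 0 <= ip k k := hil_ge0 hH _ Hk.
rewrite {1}/k ipBl ?ipZl//; try exact: hilZ.
rewrite (hilC hH _ _ Hk Hf) (hilC hH _ _ Hk Hh) kf kh rmorph0 mulr0 subr0.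
rewrite rmorphB !rmorphM/= cc -(hilC hH f f)// conjcK pmulr_rge0; last first.
  by rewrite lt_def c0 (hil_ge0 hH).
by rewrite subr_ge0 [ip f f * _]mulrC [z^* * _]mulrC.
Qed.

(** By Cauchy-Schwarz $|c|^2$ is bounded by a null sequence. This is the form of continuity of the
    inner product that shows the residual of an alternating limit to be orthogonal to the
    intersection. *)
Lemma cvg_ip_eq0 (u : nat -> V) l h c : (forall n, H (u n)) -> H l -> H h ->
  sqn (u n - l) @[n --> \oo] --> (0 : R) ->
  (forall n, ip (u n - l) h = c) -> c = 0.
Proof.
move=> Hu Hl Hh ul cE.
have cle n : complex.Re (`|c| ^+ 2) <= sqn (u n - l) * sqn h.
  have Hd : H (u n - l) by exact: hilB.
  have := Cauchy_Schwarz _ _ Hd Hh; rewrite cE !ip_sqn// -rmorphM/=.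
  by rewrite lecE => /andP[_ /=].
have c0 : complex.Re (`|c| ^+ 2) <= 0.
  have lim0 : sqn (u n - l) * sqn h @[n --> \oo] --> (0 : R).
    by rewrite -[X in _ --> X](mul0r (sqn h)); apply: cvgMr_tmp.
  by rewrite -(cvg_lim _ lim0)//; apply: limr_ge; [apply/cvg_ex; eexists; exact: lim0|apply: nearW].
have : `|c| ^+ 2 = 0.
  apply/eqP; rewrite eq_le exprn_ge0// andbT -add_Re2_Im2 lecR.
  by move: c0; rewrite -add_Re2_Im2.
by move/eqP; rewrite expf_eq0/= normr_eq0 => /eqP.
Qed.

(** * Consequences of orthogonality of the residual *)

Section Projection.
Context {U : set V} {P : V -> V}.
Hypothesis PU : orthproj H ip U P.

Lemma proj_sub f : U f -> H f. Proof. by case: PU => UH _ _ _; exact: UH. Qed.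

Lemma proj_mem f : H f -> U (P f). Proof. by case: PU => _ _ _ /(_ f) + Hf => /(_ Hf)[]. Qed.

Lemma proj_hil f : H f -> H (P f).
Proof. by move=> Hf; apply/proj_sub/proj_mem. Qed.

Lemma proj_orth f h : H f -> U h -> ip (f - P f) h = 0.
Proof. by case: PU => _ _ _ /(_ f) + Hf => /(_ Hf)[_]; exact. Qed.

Lemma proj_subB f h : U f -> U h -> U (f - h).
Proof.
by case: PU => _ _ UP _ Uf Uh; rewrite addrC -scaleN1r; exact: UP.
Qed.

(** The vector [P f - p] lies in [U] and, as a difference of two residuals of [f], is orthogonal to
    [U], hence to itself. Linearity and idempotence of [P] are read off from this. *)
Lemma proj_unique f p : H f -> U p -> (forall h, U h -> ip (f - p) h = 0) ->
  P f = p.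
Proof.
move=> Hf Up pP; apply/eqP; rewrite -subr_eq0; apply/eqP.
have Ud : U (P f - p) by apply: proj_subB => //; exact: proj_mem.
have Hp := proj_sub _ Up; have HPf := proj_hil _ Hf; have Hd := proj_sub _ Ud.
apply: (hil_def hH) => //.
rewrite -[X in ip X _](_ : (f - p) - (f - P f) = _); last first.
  by rewrite opprB addrC addrA subrK.
by rewrite ipBl ?pP ?proj_orth ?subr0//; exact: hilB.
Qed.

Lemma proj_id f : U f -> P f = f.
Proof.
move=> Uf; apply: proj_unique => //; first exact: proj_sub.
by move=> h Uh; rewrite subrr ip0l//; exact: proj_sub.
Qed.

Lemma proj_idem f : H f -> P (P f) = P f.
Proof. by move=> Hf; rewrite proj_id//; exact: proj_mem. Qed.

Lemma proj_linear a f h : H f -> H h -> P (a *: f + h) = a *: P f + P h.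
Proof.
move=> Hf Hh; have [UH _ UP _] := PU.
have [HPf HPh] := (proj_hil _ Hf, proj_hil _ Hh).
apply: proj_unique; first exact: (hilP hH).
  by apply: UP; exact: proj_mem.
move=> k Uk; have Hk := UH _ Uk.
rewrite opprD addrACA -scalerBr (hil_lin hH)//; try exact: hilB.
by rewrite !proj_orth// mulr0 addr0.
Qed.

Lemma proj_sa f h : H f -> H h -> ip (P f) h = ip f (P h).
Proof.
move=> Hf Hh; have [HPf HPh] := (proj_hil _ Hf, proj_hil _ Hh).
transitivity (ip (P f) (P h)).
  apply/eqP; rewrite -subr_eq0 -ipBr//; apply/eqP.
  rewrite (hilC hH)//; last exact: hilB.
  by rewrite proj_orth// ?rmorph0//; exact: proj_mem.
apply/eqP; rewrite eq_sym -subr_eq0 -ipBl//; apply/eqP.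
by rewrite proj_orth//; exact: proj_mem.
Qed.

Lemma proj_pythagoras f : H f -> sqn f = sqn (P f) + sqn (f - P f).
Proof.
move=> Hf; have HPf := proj_hil _ Hf.
have e : ip f (P f) = (sqn (P f))%:C.
  by rewrite -{1}(proj_idem _ Hf) -proj_sa// -ip_sqn.
rewrite sqnB_eq// e /=; lra.
Qed.

Lemma proj_le f : H f -> sqn (P f) <= sqn f.
Proof.
move=> Hf; rewrite (proj_pythagoras _ Hf) lerDl sqn_ge0//; apply: hilB => //.
exact: proj_hil.
Qed.

(** By Pythagoras the residual has norm zero. This later turns a fixed point of [F E F] into a fixed
    point of each factor. *)
Lemma proj_eq f : H f -> sqn f <= sqn (P f) -> P f = f.
Proof.
move=> Hf le; apply/esym/eqP; rewrite -subr_eq0; apply/eqP/sqn_eq0.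
  by apply: hilB => //; exact: proj_hil.
apply/eqP; rewrite eq_le sqn_ge0 ?andbT; last first.
  by apply: hilB => //; exact: proj_hil.
by move: le; rewrite {1}(proj_pythagoras _ Hf); lra.
Qed.

Lemma projB f h : H f -> H h -> P (f - h) = P f - P h.
Proof.
by move=> Hf Hh; rewrite addrC -scaleN1r proj_linear// scaleN1r addrC.
Qed.

(** The residual of [u n - l] is [P l - l] for every [n], because [P] fixes [u n]. By Pythagoras its
    norm is at most that of [u n - l], which tends to 0. *)
Lemma proj_closed (u : nat -> V) l : (forall n, U (u n)) -> H l ->
  sqn (u n - l) @[n --> \oo] --> (0 : R) -> U l.
Proof.
move=> Uu Hl ul; have HPl := proj_hil _ Hl.
have Hu n : H (u n) := proj_sub _ (Uu n).
suff -> : l = P l by exact: proj_mem.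
have Hd : H (P l - l) by exact: hilB.
apply/esym/eqP; rewrite -subr_eq0; apply/eqP; apply: sqn_eq0 => //.
apply/eqP; rewrite eq_le sqn_ge0// andbT -(cvg_lim _ ul)//.
apply: limr_ge; first by apply/cvg_ex; eexists; exact: ul.
apply: nearW => n; have Hn : H (u n - l) by exact: hilB.
rewrite (proj_pythagoras _ Hn) projB// (proj_id _ (Uu n)).
rewrite (_ : u n - l - (u n - P l) = P l - l); last first.
  by rewrite opprB [P l - u n]addrC addrA [u n - l - u n]addrAC subrr add0r addrC.
by rewrite lerDr sqn_ge0//; exact: hilB.
Qed.

End Projection.

(* With T = F E F, self-adjoint and contractive, the numbers <T^n f, f> decrease,
   and |T^i f - T^j f|^2 = <T^2i f, f> - 2 <T^(i+j) f, f> + <T^2j f, f>. *)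
Section AlternatingProjections.
Context {U W : set V} {E F : V -> V}.
Hypotheses (EU : orthproj H ip U E) (FW : orthproj H ip W F).

Let T f := F (E (F f)).

Let HE f : H f -> H (E f). Proof. exact: (proj_hil EU). Qed.
Let HF f : H f -> H (F f). Proof. exact: (proj_hil FW). Qed.
Let HT n f : H f -> H (iter n T f).
Proof. by move=> Hf; elim: n => //= n IH; apply/HF/HE/HF. Qed.

Let T_sa n f h : H f -> H h -> ip (iter n T f) h = ip f (iter n T h).
Proof.
elim: n h => // n IH h Hf Hh; rewrite iterS iterSr.
rewrite /T (proj_sa FW) ?(proj_sa EU) ?(proj_sa FW) ?IH//; auto.
Qed.

Let a f n := complex.Re (ip (iter n T f) f).

Let ipT f i j : H f -> ip (iter i T f) (iter j T f) = ip (iter (j + i) T f) f.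
Proof. by move=> Hf; rewrite -T_sa ?iterD//; exact: HT. Qed.

Let a_even f n : H f -> a f (n + n) = sqn (iter n T f).
Proof. by move=> Hf; rewrite /a -ipT. Qed.

Let a_odd f n : H f -> a f (n + n).+1 = sqn (E (F (iter n T f))).
Proof.
move=> Hf; have Hn := HT n _ Hf.
rewrite /a -addnS -ipT// iterS /sqn; congr complex.Re.
rewrite {1}/T (proj_sa FW)//; last by apply/HE/HF.
by rewrite -(proj_sa EU) ?(proj_idem EU)//; auto.
Qed.

(** Even and odd terms are the squared norms of [iter n T f] and of [E (F (iter n T f))], and one
    more application of [F] to the latter gives the next even term; each half step is a
    contraction. *)
Let a_anti f : H f -> {homo a f : i j / (i <= j)%N >-> j <= i}.
Proof.
move=> Hf; apply: (@homo_leq _ _ (fun x y => y <= x)) => //.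
  by move=> y x z xy yz; exact: le_trans yz xy.
move=> n; have [->|->] : n = (n./2 + n./2)%N \/ n = (n./2 + n./2).+1.
- by rewrite addnn -{1 3}(odd_double_half n); case: (odd n); [right|left].
- rewrite a_odd// a_even//.
  by apply: (le_trans (proj_le EU _ _)); [exact/HF/HT|exact/(proj_le FW)/HT].
- rewrite a_odd// -addSn -addnS a_even//=.
  by apply: (proj_le FW); exact/HE/HF/HT.
Qed.

Let a_ge0 f n : H f -> 0 <= a f n.
Proof.
move=> Hf; apply: le_trans (a_anti f Hf _ _ (leq_addr n n)).
by rewrite a_even// sqn_ge0//; exact: HT.
Qed.

Let sqn_aB f i j : H f ->
  sqn (iter i T f - iter j T f) = a f (i + i) - a f (i + j) *+ 2 + a f (j + j).
Proof.
by move=> Hf; rewrite sqnB_eq ?a_even ?ipT// 1?addnC//; exact: HT.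
Qed.

Let T_cvg f : H f -> exists2 l, H l &
  sqn (iter n T f - l) @[n --> \oo] --> (0 : R).
Proof.
move=> Hf; apply: (hil_complete hH) => [n|e e0]; first exact: HT.
have ca : cvg (a f @ \oo).
  apply: nonincreasing_is_cvgn; first by move=> i j; exact: a_anti.
  by exists 0 => _ [n _ <-]; exact: a_ge0.
(* The values of [a f] enter [sqn_aB] with weights 1, -2 and 1, whose absolute values add up to
   4. *)
have e4 : 0 < e / 4 by lra.
have /cvgrPdist_lt/(_ _ e4)[N _ NP] := ca.
exists N => i j Ni Nj; rewrite -/(sqn _) sqn_aB//.
have h n : (N <= n)%N -> `|lim (a f @ \oo) - a f n| < e / 4 by exact: NP.
have := h (i + i)%N (leq_trans Ni (leq_addr _ _)).
have := h (i + j)%N (leq_trans Ni (leq_addr _ _)).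
have := h (j + j)%N (leq_trans Nj (leq_addr _ _)).
by rewrite !ltr_norml => /andP[? ?] /andP[? ?] /andP[? ?]; lra.
Qed.

(** Idempotence of [F] merges the two adjacent copies of [F] between [E F] and [T]. Thus convergence
    passes from the self-adjoint [T] to the product [E F]. *)
Let iterEF n f : H f -> iter n.+1 (E \o F) f = E (F (iter n T f)).
Proof.
move=> Hf; elim: n => // n IH; rewrite iterS IH /=.
by rewrite (proj_idem FW)//; exact/HE/HF/HT.
Qed.

Let sqn_lim_unique (u : nat -> V) k l : (forall n, H (u n)) -> H k -> H l ->
  sqn (u n - k) @[n --> \oo] --> (0 : R) ->
  sqn (u n - l) @[n --> \oo] --> (0 : R) -> k = l.
Proof.
move=> Hu Hk Hl uk ul; apply/eqP; rewrite -subr_eq0; apply/eqP.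
have Hd : H (k - l) by exact: hilB.
apply: sqn_eq0 => //; apply/eqP; rewrite eq_le sqn_ge0// andbT.
have s0 : 2 * sqn (u n - l) + 2 * sqn (u n - k) @[n --> \oo] --> (0 : R).
  rewrite (_ : 0 = 2 * 0 + 2 * 0 :> R); last by rewrite mulr0 addr0.
  by apply: cvgD; apply: cvgMl_tmp.
rewrite -(cvg_lim _ s0)//; apply: limr_ge; first by apply/cvg_ex; eexists; exact: s0.
apply: nearW => n; rewrite -[k - l](_ : (u n - l) - (u n - k) = _).
  by apply: sqnB_le; exact: hilB.
by rewrite opprB addrC addrA subrK.
Qed.

Theorem alternating_projections : exists2 P, orthproj H ip (U `&` W) P &
  forall f, H f -> sqn (iter n (E \o F) f - P f) @[n --> \oo] --> (0 : R).
Proof.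
have key f : exists l, H f -> [/\ U l, W l, forall h, U h -> W h -> ip (f - l) h = 0
    & sqn (iter n (E \o F) f - l) @[n --> \oo] --> (0 : R)].
  (* [choice] wants a value at every vector of the ambient module; outside [H] it is an arbitrary
     default. *)
  have [Hf|nHf] := pselect (H f); last by exists 0.
  have [l Hl Tl] := T_cvg _ Hf; exists l => _.
  have HTl : H (T l) by apply/HF/HE/HF.
  have EFle k : H k -> sqn (E (F k)) <= sqn k.
    by move=> Hk; apply: (le_trans (proj_le EU _ _)); [exact: HF|exact: (proj_le FW)].
  have EFB h k : H h -> H k -> E (F h) - E (F k) = E (F (h - k)).
    by move=> Hh Hk; rewrite (projB FW)// (projB EU)//; exact: HF.
  (* The shifted sequence converges to [l], and also to [T l] because [T] is linear on differences
     and contractive. *)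
  have TlE : T l = l.
    apply: (sqn_lim_unique (fun n => iter n.+1 T f)) => //.
    - by move=> n; exact: HT.
    - apply: (squeeze_cvgr _ (cvg_cst 0) Tl); apply: nearW => n.
      have Hn := HT n _ Hf; rewrite sqn_ge0/=; last exact/hilB/HTl/HF/HE/HF.
      rewrite /T -(projB FW) ?EFB//; try by apply/HE/HF.
      apply: (le_trans (proj_le FW _ _)); first exact/HE/HF/hilB.
      exact/EFle/hilB.
    - by have := Tl; rewrite -(cvg_shiftS (fun n => sqn (iter n T f - l))).
  (* Since [l = F (E (F l))], the factor [F] applied first cannot shorten [l], so [F] fixes [l];
     then [l = F (E l)] gives the same for [E]. *)
  have Fl : F l = l.
    apply: (proj_eq FW) => //; rewrite -{1}TlE.
    apply: (le_trans (proj_le FW _ _)); first exact/HE/HF.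
    exact/(proj_le EU)/HF.
  have El : E l = l.
    apply: (proj_eq EU) => //; rewrite -{1}TlE /T Fl.
    exact/(proj_le FW)/HE.
  have Ul : U l by rewrite -El; exact: (proj_mem EU).
  have Wl : W l by rewrite -Fl; exact: (proj_mem FW).
  have EFl : sqn (iter n (E \o F) f - l) @[n --> \oo] --> (0 : R).
    rewrite -(cvg_shiftS (fun n => sqn (iter n (E \o F) f - l))).
    apply: (squeeze_cvgr _ (cvg_cst 0) Tl); apply: nearW => n.
    change (0 <= sqn (iter n.+1 (E \o F) f - l) <= sqn (iter n T f - l)).
    have Hn := HT n _ Hf.
    have -> : iter n.+1 (E \o F) f - l = E (F (iter n T f - l)).
      by rewrite iterEF// -EFB// Fl El.
    by rewrite sqn_ge0 ?EFle//; [exact: hilB|exact/HE/HF/hilB].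
  split=> // h Uh Wh; have Hh := proj_sub EU _ Uh.
  (* [T] is self-adjoint and fixes [h], so the pairing of [iter n T f - l] with [h] equals that of
     [f - l] for every [n]. *)
  apply: (cvg_ip_eq0 (fun n => iter n T f) l h _ (fun n => HT n _ Hf) Hl Hh Tl) => n.
  have Hn := HT n _ Hf; rewrite !ipBl//; congr (_ - _).
  rewrite T_sa//; congr (ip f _); elim: n {Hn} => //= n ->.
  by rewrite /T (proj_id FW)// (proj_id EU)// (proj_id FW).
have [P PP] := choice key; exists P; last by move=> f /PP[].
split=> [f [/(proj_sub EU)]//| | |f /PP[]].
- by split; [have [] := EU|have [] := FW].
- move=> c f h [Uf Wf] [Uh Wh]; have [_ _ UP _] := EU; have [_ _ WP _] := FW.
  by split; [exact: UP|exact: WP].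
- by move=> Uf Wf fP _; split => // h []; exact: fP.
Qed.

End AlternatingProjections.

End Hilbert.

(** * Absolutely convergent sums *)

Section Cnorm.
Context {R : realType}.
Implicit Types (z w : R[i]) (x : R).

(** The norm of [R[i]] has values in [R[i]]; its real part makes the ordered field [R] available for
    estimates. *)
Definition cnorm z : R := complex.Re `|z|.

Lemma cnormC z : (cnorm z)%:C = `|z|.
Proof. by rewrite /cnorm RRe_real// ger0_real. Qed.

Lemma cnorm_ge0 z : 0 <= cnorm z.
Proof. by rewrite -ler0c cnormC. Qed.

Lemma cnormD z w : cnorm (z + w) <= cnorm z + cnorm w.
Proof. by rewrite -lecR rmorphD/= !cnormC ler_normD. Qed.

Lemma cnormM z w : cnorm (z * w) = cnorm z * cnorm w.
Proof. by apply: complexI; rewrite rmorphM/= !cnormC normrM. Qed.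

Lemma cnormN z : cnorm (- z) = cnorm z.
Proof. by rewrite /cnorm normrN. Qed.

Lemma cnorm0 : cnorm 0 = 0. Proof. by rewrite /cnorm normr0. Qed.

Lemma cnorm1 : cnorm 1 = 1. Proof. by rewrite /cnorm normr1. Qed.

Lemma cnormX z n : cnorm (z ^+ n) = cnorm z ^+ n.
Proof. by elim: n => [|n IH]; rewrite ?expr0 ?cnorm1// !exprS cnormM IH. Qed.

Lemma cnormV z : cnorm z^-1 = (cnorm z)^-1.
Proof. by apply: complexI; rewrite fmorphV/= !cnormC normfV. Qed.

Lemma cnorm_prod (I : finType) (u : I -> R[i]) :
  cnorm (\prod_i u i) = \prod_i cnorm (u i).
Proof. exact: (big_morph cnorm cnormM cnorm1). Qed.

Lemma cnorm_sum (I : Type) (r : seq I) (u : I -> R[i]) :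
  cnorm (\sum_(i <- r) u i) <= \sum_(i <- r) cnorm (u i).
Proof.
elim: r => [|i r IH]; first by rewrite !big_nil cnorm0.
by rewrite !big_cons; apply: le_trans (cnormD _ _) _; rewrite lerD2l.
Qed.

Lemma cnorm_conj z : cnorm z^* = cnorm z.
Proof. by apply: complexI; rewrite !cnormC normcJ. Qed.

Lemma cnorm_real x : cnorm x%:C = `|x|.
Proof.
by rewrite /cnorm normc_def/= expr0n/= addr0 sqrtr_sqr.
Qed.

Lemma cnorm_sqr z : cnorm z ^+ 2 = complex.Re (`|z| ^+ 2).
Proof. by apply: complexI; rewrite -[in RHS]add_Re2_Im2 add_Re2_Im2 rmorphXn/= cnormC. Qed.

Lemma cnorm_eq0 z : cnorm z = 0 -> z = 0.
Proof. by move=> z0; apply/eqP; rewrite -normr_eq0 -cnormC z0. Qed.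

Lemma cnorm_Re z : `|complex.Re z| <= cnorm z.
Proof. by rewrite -lecR cnormC normc_ge_Re. Qed.

Lemma cnorm_Im z : `|complex.Im z| <= cnorm z.
Proof.
rewrite /cnorm normc_def/= -{1}sqrtr_sqr ler_sqrt ?addr_ge0 ?sqr_ge0//.
by rewrite lerDr sqr_ge0.
Qed.

End Cnorm.

(** For nonnegative [u] this is summability with an explicit bound, stated on finite sets so that
    comparisons avoid extended reals. *)
Definition bsum {R : realType} {I : choiceType} (u : I -> R) (M : R) : Prop :=
  forall F : {fset I}, \sum_(i <- F) u i <= M.

Definition csummable {R : realType} {I : choiceType} (u : I -> R[i]) : Prop :=
  exists M : R, bsum (fun i => cnorm (u i)) M.

Section Bsum.
Context {R : realType} {I : choiceType}.
Implicit Types (u v : I -> R) (M : R) (F G : {fset I}).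

Lemma sum_fset_mono {u F G} : (forall i, 0 <= u i) -> (F `<=` G)%fset ->
  \sum_(i <- F) u i <= \sum_(i <- G) u i.
Proof.
move=> u0 FG; rewrite [leRHS](big_fsetID _ (mem F))/=.
rewrite (_ : [fset x | x in G & x \in F]%fset = F) ?lerDl ?sumr_ge0//.
by apply/fsetP => x; rewrite !inE/= andbC; case: (boolP (x \in F)) => //= /(fsubsetP FG).
Qed.

Lemma esum_ge_fset u F : ((\sum_(i <- F) u i)%:E <= \esum_(i in [set: I]) (u i)%:E)%E.
Proof.
apply: esum_ge; exists [set` F]; first by split.
by rewrite fsbig_finite//= set_fsetK sumEFin.
Qed.

Lemma esum_le_bsum u M : bsum u M -> (\esum_(i in [set: I]) (u i)%:E <= M%:E)%E.
Proof.
move=> uM; apply: ge_ereal_sup => _ [A [finA _] <-].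
by rewrite fsbig_finite//= sumEFin lee_fin.
Qed.

Lemma bsum_ge0 u M : bsum u M -> 0 <= M.
Proof. by move=> /(_ fset0); rewrite big_seq_fset0. Qed.

Lemma esum_fineK u M : (forall i, 0 <= u i) -> bsum u M ->
  (fine (\esum_(i in [set: I]) (u i)%:E))%:E = \esum_(i in [set: I]) (u i)%:E.
Proof.
move=> u0 uM; rewrite fineK// ge0_fin_numE ?esum_ge0//.
  by apply: le_lt_trans (esum_le_bsum _ _ uM) _; rewrite ltry.
by move=> i _; rewrite lee_fin.
Qed.

Lemma esum_lty_bsum u : (forall i, 0 <= u i) ->
  (\esum_(i in [set: I]) (u i)%:E < +oo)%E ->
  bsum u (fine (\esum_(i in [set: I]) (u i)%:E)).
Proof.
move=> u0 uoo F; rewrite -lee_fin fineK ?esum_ge_fset//.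
by rewrite ge0_fin_numE// esum_ge0// => i _; rewrite lee_fin.
Qed.

Lemma bsum_le u v M : (forall i, u i <= v i) -> bsum v M -> bsum u M.
Proof. by move=> uv vM F; apply: le_trans (vM F); apply: ler_sum. Qed.

Lemma bsumD u v M N : bsum u M -> bsum v N -> bsum (fun i => u i + v i) (M + N).
Proof. by move=> uM vN F; rewrite big_split lerD. Qed.

Lemma bsumZ u M (c : R) : 0 <= c -> bsum u M -> bsum (fun i => c * u i) (c * M).
Proof. by move=> c0 uM F; rewrite -mulr_sumr ler_wpM2l. Qed.

(** Zero terms are dropped first, so [phi] has to be injective only on the support of [u]. This fits
    index maps such as [mono_down] or the removal of an element from [S], which are not injective
    everywhere. *)
Lemma bsum_inj {J : choiceType} (u : I -> R) (v : J -> R) (phi : I -> J) (psi : J -> I)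
    (c M : R) : 0 <= c -> (forall j, 0 <= v j) -> (forall i, 0 <= u i) ->
  (forall i, u i != 0 -> u i <= c * v (phi i) /\ psi (phi i) = i) ->
  bsum v M -> bsum u (c * M).
Proof.
move=> c0 v0 u0 uv vM F.
have [F' F'P ->] : exists2 F' : {fset I}, forall i, i \in F' -> u i != 0 &
    \sum_(i <- F) u i = \sum_(i <- F') u i.
  exists [fset i in F | u i != 0]%fset => [i|]; first by rewrite !inE/= => /andP[].
  rewrite (big_fsetID _ (fun i => u i != 0))/= addrC big_seq big1 ?add0r// => i.
  by rewrite !inE/= negbK => /andP[_ /eqP].
apply: (@le_trans _ _ (c * \sum_(j <- [fset phi i | i in F']%fset) v j)); last first.
  by rewrite ler_wpM2l.
rewrite big_imfset/= => [|i j]; last first.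
  move=> /F'P/uv[_ ii] /F'P/uv[_ jj] e.
  by rewrite -ii -jj e.
rewrite mulr_sumr big_seq [leRHS]big_seq; apply: ler_sum => i.
by move=> /F'P/uv[].
Qed.

End Bsum.

(** * Unordered convergence of complex families *)

Section Csum.
Context {R : realType}.

(** Convergence along the net of finite subsets. The positive and negative parts that define [csum]
    are not additive, so linearity is proved for [has_csum] and transferred by [csumP] and
    [csumE]. *)
Definition has_csum {I : choiceType} (u : I -> R[i]) (s : R[i]) : Prop :=
  forall e : R, 0 < e -> exists F : {fset I}, forall G : {fset I},
    (F `<=` G)%fset -> cnorm (\sum_(i <- G) u i - s) <= e.

Context {I : choiceType}.
Implicit Types (u v : I -> R[i]) (s t a : R[i]) (M : R) (F G : {fset I}).

Lemma has_csum_unique u s t : has_csum u s -> has_csum u t -> s = t.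
Proof.
move=> us ut; apply/eqP; rewrite -subr_eq0; apply/eqP/cnorm_eq0.
apply/eqP; rewrite eq_le cnorm_ge0 andbT; apply/ler_addgt0Pl => e e0.
have e2 : 0 < e / 2 by lra.
have [F FP] := us _ e2; have [G GP] := ut _ e2.
have h1 := FP _ (fsubsetUl F G); have h2 := GP _ (fsubsetUr F G).
set S := \sum_(i <- _) _ in h1 h2.
rewrite (_ : s - t = (S - t) - (S - s)); last by ring.
by apply: le_trans (cnormD _ _) _; rewrite cnormN; lra.
Qed.

Lemma has_csumD u v s t : has_csum u s -> has_csum v t ->
  has_csum (fun i => u i + v i) (s + t).
Proof.
move=> us vt e e0; have e2 : 0 < e / 2 by lra.
have [F FP] := us _ e2; have [G GP] := vt _ e2.
exists (F `|` G)%fset => K; rewrite fsubUset => /andP[/FP h1 /GP h2].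
rewrite big_split opprD addrACA.
by apply: le_trans (cnormD _ _) _; lra.
Qed.

Lemma has_csumZ a u s : has_csum u s -> has_csum (fun i => a * u i) (a * s).
Proof.
move=> us e e0; have a0 := cnorm_ge0 a.
have a1 : 0 < cnorm a + 1 by lra.
have e1 : 0 < e / (cnorm a + 1) by rewrite divr_gt0.
have [F FP] := us _ e1; exists F => G /FP h.
rewrite -mulr_sumr -mulrBr cnormM.
apply: le_trans (ler_wpM2l a0 h) _.
by rewrite mulrA ler_pdivrMr// mulrC ler_pM2l//; lra.
Qed.

Lemma has_csum_conj u s : has_csum u s -> has_csum (fun i => (u i)^*) s^*.
Proof.
move=> us e e0; have [F FP] := us _ e0; exists F => G /FP.
by rewrite -rmorph_sum -rmorphB cnorm_conj.
Qed.

Lemma has_csum_bound u s M : has_csum u s -> bsum (fun i => cnorm (u i)) M ->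
  cnorm s <= M.
Proof.
move=> us uM; apply/ler_addgt0Pl => e e0; have [F FP] := us _ e0.
rewrite (_ : s = \sum_(i <- F) u i - (\sum_(i <- F) u i - s)); last first.
  by ring.
apply: le_trans (cnormD _ _) _; rewrite cnormN addrC; apply: lerD; first exact: FP.
exact: le_trans (cnorm_sum _ _ _) (uM F).
Qed.

Lemma rsum_ge0E (u : I -> R) : (forall i, 0 <= u i) ->
  rsum u = fine (\esum_(i in [set: I]) (u i)%:E).
Proof.
move=> u0; rewrite /rsum.
rewrite [X in _ - fine X]esum1 ?subr0/=; last first.
  by move=> i _; rewrite max_r// oppr_le0.
by congr fine; apply: eq_esum => i _; rewrite max_l.
Qed.

Lemma has_csum_ge0 (u : I -> R) M : (forall i, 0 <= u i) -> bsum u M ->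
  has_csum (fun i => (u i)%:C) (fine (\esum_(i in [set: I]) (u i)%:E))%:C.
Proof.
move=> u0 uM e e0; set S := fine _.
have SE := esum_fineK _ _ u0 uM; rewrite -/S in SE.
have [F SF] : exists F : {fset I}, S - e < \sum_(i <- F) u i.
  have : ((S - e)%:E < \esum_(i in [set: I]) (u i)%:E)%E.
    by rewrite -SE lte_fin; lra.
  move=> /ereal_sup_gt[_ [A [finA _] <-]].
  by rewrite fsbig_finite//= sumEFin lte_fin; exists (fset_set A).
exists F => G FG; rewrite -rmorph_sum -rmorphB/= cnorm_real.
have h1 := sum_fset_mono u0 FG.
have h2 : \sum_(i <- G) u i <= S by rewrite -lee_fin SE esum_ge_fset.
by rewrite ler_norml; lra.
Qed.

Lemma has_rsum (u : I -> R) M : bsum (fun i => `|u i|) M ->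
  has_csum (fun i => (u i)%:C) (rsum u)%:C.
Proof.
move=> uM.
have h (v : I -> R) : (forall i, v i <= `|u i|) ->
    has_csum (fun i => (Num.max (v i) 0)%:C)
      (fine (\esum_(i in [set: I]) (Num.max (v i) 0)%:E))%:C.
  move=> vu; apply: (@has_csum_ge0 _ M) => [i|]; first by rewrite le_max lexx orbT.
  by apply: bsum_le uM => i; rewrite ge_max vu normr_ge0.
have h1 := h u (fun i => ler_norm _).
have h2 := h (fun i => - u i).
have {}h2 := h2 ltac:(by move=> i; rewrite -normrN ler_norm).
rewrite /rsum rmorphB/= -mulN1r.
rewrite (_ : (fun i => _) = fun i => (Num.max (u i) 0)%:C + -1 * (Num.max (- u i) 0)%:C).
  exact: (has_csumD _ _ _ _ h1 (has_csumZ _ _ _ h2)).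
apply/funext => i; rewrite mulN1r -rmorphB/=; congr (_%:C).
have [ui|ui] := leP (u i) 0.
  have ui' : 0 <= - u i by rewrite oppr_ge0.
  by rewrite (max_l ui') sub0r opprK.
have ui' : - u i <= 0 by rewrite oppr_le0 ltW.
by rewrite (max_r ui') subr0.
Qed.

Lemma csumP u : csummable u -> has_csum u (csum u).
Proof.
move=> [M uM].
have hR : has_csum (fun i => (complex.Re (u i))%:C) (rsum (fun i => complex.Re (u i)))%:C.
  by apply: (@has_rsum _ M); apply: bsum_le uM => i; exact: cnorm_Re.
have hI : has_csum (fun i => (complex.Im (u i))%:C) (rsum (fun i => complex.Im (u i)))%:C.
  by apply: (@has_rsum _ M); apply: bsum_le uM => i; exact: cnorm_Im.
rewrite [csum u]complexE /=.
rewrite [X in has_csum X](_ : u = fun i => (complex.Re (u i))%:C + 'i * (complex.Im (u i))%:C).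
  exact: (has_csumD _ _ _ _ hR (has_csumZ _ _ _ hI)).
by apply/funext => i; rewrite -complexE.
Qed.

Lemma csumE u s : csummable u -> has_csum u s -> csum u = s.
Proof. by move=> /csumP; exact: has_csum_unique. Qed.

Lemma csummable_le u (b : I -> R) M : (forall i, cnorm (u i) <= b i) -> bsum b M ->
  csummable u.
Proof. by move=> ub bM; exists M; exact: bsum_le bM. Qed.

Lemma csummableD u v : csummable u -> csummable v -> csummable (fun i => u i + v i).
Proof.
move=> [M uM] [N vN]; apply: (csummable_le _ _ (M + N) _ (bsumD _ _ _ _ uM vN)).
by move=> i; exact: cnormD.
Qed.

Lemma csummableZ a u : csummable u -> csummable (fun i => a * u i).
Proof.
move=> [M uM].
apply: (csummable_le _ _ _ _ (bsumZ _ _ _ (cnorm_ge0 a) uM)) => i.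
by rewrite cnormM.
Qed.

Lemma csumD u v : csummable u -> csummable v ->
  csum (fun i => u i + v i) = csum u + csum v.
Proof.
move=> su sv; apply: csumE; first exact: csummableD.
by apply: has_csumD; exact: csumP.
Qed.

Lemma csumZ a u : csummable u -> csum (fun i => a * u i) = a * csum u.
Proof.
move=> su; apply: csumE; first exact: csummableZ.
by apply: has_csumZ; exact: csumP.
Qed.

Lemma csum_conj u : csummable u -> csum (fun i => (u i)^*) = (csum u)^*.
Proof.
move=> su; apply: csumE; last exact/has_csum_conj/csumP.
case: su => M uM; exists M; apply: bsum_le uM => i.
by rewrite cnorm_conj.
Qed.

Lemma csum_bound u M : bsum (fun i => cnorm (u i)) M -> cnorm (csum u) <= M.
Proof.
by move=> uM; apply: (has_csum_bound u) => //; apply: csumP; exists M.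
Qed.

Lemma csum0 : csum (fun _ : I => 0 : R[i]) = 0.
Proof.
apply: csumE; first by exists 0 => F; rewrite big1// => i _; rewrite cnorm0.
by move=> e e0; exists fset0 => G _; rewrite big1// subrr cnorm0 ltW.
Qed.

Lemma csum_sum {J : Type} (r : seq J) (u : J -> I -> R[i]) :
  (forall j, csummable (u j)) ->
  csummable (fun i => \sum_(j <- r) u j i) /\
  csum (fun i => \sum_(j <- r) u j i) = \sum_(j <- r) csum (u j).
Proof.
move=> su; elim: r => [|j r [IH1 IH2]].
  rewrite big_nil; under eq_fun do rewrite big_nil; split; last exact: csum0.
  by exists 0 => F; rewrite big1// => i _; rewrite cnorm0.
rewrite big_cons -IH2 -csumD//; under eq_fun do rewrite big_cons; split => //.
exact: csummableD.
Qed.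

Lemma csum_ge0 (u : I -> R) : (forall i, 0 <= u i) ->
  csum (fun i => (u i)%:C) = (fine (\esum_(i in [set: I]) (u i)%:E))%:C.
Proof.
move=> u0; apply/eqP; rewrite eq_complex /= rsum_ge0E// eqxx/=.
by rewrite rsum_ge0E// esum1.
Qed.

Lemma csum1 u i0 : (forall i, i != i0 -> u i = 0) -> csum u = u i0.
Proof.
move=> u0; apply: csumE.
  exists (cnorm (u i0)) => F; have [iF|iF] := boolP (i0 \in F).
    rewrite (big_fsetD1 i0)//= big_seq big1 ?addr0// => i.
    by rewrite !inE => /andP[/u0 -> _]; rewrite cnorm0.
  rewrite big_seq big1 ?cnorm_ge0// => i iF'; rewrite u0 ?cnorm0//.
  by apply: contraNneq iF => <-.
move=> e e0; exists [fset i0]%fset => G; rewrite fsub1set => iG.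
rewrite (big_fsetD1 i0)//= big_seq big1 ?addr0 ?subrr ?cnorm0 ?ltW// => i.
by rewrite !inE => /andP[/u0].
Qed.

End Csum.

Section Reindex.
Context {R : realType} {I J : choiceType}.
Variables (phi : I -> J) (psi : J -> I).

Lemma esum_reindex_supp (u : I -> R) (v : J -> R) :
  (forall i, u i != 0 -> v (phi i) = u i /\ psi (phi i) = i) ->
  (forall j, v j != 0 -> u (psi j) = v j /\ phi (psi j) = j) ->
  \esum_(i in [set: I]) (Num.max (u i) 0)%:E = \esum_(j in [set: J]) (Num.max (v j) 0)%:E.
Proof.
move=> uv vu.
have supp (K : choiceType) (w : K -> R) :
    \esum_(i in [set: K]) (Num.max (w i) 0)%:E =
    \esum_(i in [set i | w i != 0]) (Num.max (w i) 0)%:E.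
  rewrite [RHS]esum_mkcond; apply: eq_esum => i _.
  case: ifPn => //; rewrite notin_setE/= => /negP; rewrite negbK => /eqP ->.
  by rewrite maxxx.
rewrite supp [RHS]supp (reindex_esum [set i | u i != 0] _ phi)//=.
  by apply: eq_esum => i /= /uv[-> _].
split.
- by move=> i /= ui; have [-> _] := uv _ ui.
- move=> i j; rewrite !inE/= => /uv[_ ii] /uv[_ jj] e.
  by rewrite -ii -jj e.
- by move=> j /= vj; have [uj jj] := vu _ vj; exists (psi j) => //=; rewrite uj.
Qed.

(** The four nonnegative sums inside [csum] are rearranged one by one along the bijection of
    supports, which works for arbitrary families; adjunctions derived from it therefore hold for all
    formal series. *)
Lemma csum_reindex (u : I -> R[i]) (v : J -> R[i]) :
  (forall i, u i != 0 -> v (phi i) = u i /\ psi (phi i) = i) ->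
  (forall j, v j != 0 -> u (psi j) = v j /\ phi (psi j) = j) ->
  csum u = csum v.
Proof.
move=> uv vu.
have h (T : R[i] -> R) : T 0 = 0 ->
    \esum_(i in [set: I]) (Num.max (T (u i)) 0)%:E =
    \esum_(j in [set: J]) (Num.max (T (v j)) 0)%:E.
  move=> T0; apply: esum_reindex_supp => [i|j].
    have [->|/uv[-> ->]//] := eqVneq (u i) 0; by rewrite T0 eqxx.
  have [->|/vu[-> ->]//] := eqVneq (v j) 0; by rewrite T0 eqxx.
rewrite /csum /rsum.
rewrite (h (fun z => complex.Re z))// (h (fun z => - complex.Re z)) ?oppr0//.
by rewrite (h (fun z => complex.Im z))// (h (fun z => - complex.Im z)) ?oppr0.
Qed.

End Reindex.

Lemma csum_pair {R : realType} {I : choiceType} {J : finType} (u : I * J -> R[i]) :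
  csummable u -> csum u = \sum_j csum (fun i => u (i, j)).
Proof.
move=> [M uM]; pose w j ij := if ij.2 == j then u ij else 0.
have sw j : csummable (w j).
  exists M; apply: bsum_le uM => ij; rewrite /w; case: ifP => // _.
  by rewrite cnorm0 cnorm_ge0.
rewrite [in LHS](_ : u = fun ij => \sum_(j <- index_enum J) w j ij); last first.
  apply/funext => -[i j]; rewrite (bigD1 j)//= /w eqxx big1 ?addr0// => k.
  by rewrite eq_sym => /negbTE /= ->.
have [_ ->] := csum_sum (index_enum J) w sw; apply: eq_bigr => j _.
apply: (csum_reindex (fun ij => ij.1) (fun i => (i, j))) => [[i k]|i]; rewrite /w /=.
  by case: (eqVneq k j) => [->|_] //; rewrite eqxx.
by rewrite eqxx.
Qed.

(** * The q-Fock space *)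

(* Inside a product the notation [z^*] is parsed in [ring_scope], as [Num.conj]. *)
Lemma numconjE {R : realType} (z : R[i]) : Num.conj z = conjc z.
Proof. by []. Qed.

Lemma conjcM {R : realType} (x y : R[i]) : conjc (x * y) = conjc x * conjc y.
Proof. exact: rmorphM. Qed.

Lemma rcM {R : realType} (x y : R) : (x * y)%:C = x%:C * y%:C.
Proof. exact: rmorphM. Qed.

Section FockSpace.
Context {R : realType} {m : nat} {q : R}.
Hypotheses (q0 : 0 < q) (q1 : q < 1).
Implicit Types (f h : fseries R m) (g : mono m) (S : {set 'I_m}) (k : var m).

Lemma qint_gt0 n : 0 < qint q n.+1.
Proof.
by rewrite /qint divr_gt0 ?subr_gt0// exprn_ilt1// ltW.
Qed.

Lemma qint0 : qint q 0 = 0.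
Proof. by rewrite /qint expr0 subrr mul0r. Qed.

Lemma qint_ge0 n : 0 <= qint q n.
Proof. by case: n => [|n]; [rewrite qint0|exact/ltW/qint_gt0]. Qed.

(** Since $q^{n+1}\le q$. This is the origin of the spectral gap of $A_q$ and $B_q$ above zero. *)
Lemma qint_ge1 n : 1 <= qint q n.+1.
Proof.
rewrite /qint ler_pdivlMr ?subr_gt0// mul1r lerD2l lerN2 exprS.
by rewrite ler_piMr ?exprn_ile1 ?ltW.
Qed.

Lemma qint_le n : qint q n <= (1 - q)^-1.
Proof.
rewrite /qint ler_pdivrMr ?subr_gt0// mulVf ?subr_eq0 ?gt_eqF//.
by rewrite gerBl exprn_ge0// ltW.
Qed.

Lemma qfactS n : qfact q n.+1 = qfact q n * qint q n.+1.
Proof. by rewrite /qfact big_nat_recr. Qed.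

Lemma qfact_gt0 n : 0 < qfact q n.
Proof.
elim: n => [|n IH]; first by rewrite /qfact big_nil.
by rewrite qfactS mulr_gt0 ?qint_gt0.
Qed.

Lemma weight_gt0 g : 0 < weight q g.
Proof. by rewrite /weight prodr_gt0// => k _; exact: qfact_gt0. Qed.

Lemma weight_up k g : weight q (mono_up k g) = weight q g * qint q (g k).+1.
Proof.
rewrite /weight (bigD1 k)//= [in RHS](bigD1 k)//= ffunE eqxx addn1 qfactS.
rewrite mulrAC; congr (_ * _ * _); apply: eq_bigr => l /negbTE lk.
by rewrite ffunE lk addn0.
Qed.

Lemma mono_upK k : cancel (mono_up k) (@mono_down m k).
Proof. by move=> g; apply/ffunP => l; rewrite !ffunE addnK. Qed.

Lemma mono_downK k g : g k != 0%N -> mono_up k (mono_down k g) = g.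
Proof.
move=> gk; apply/ffunP => l; rewrite !ffunE; case: eqP => [->|_].
  by rewrite subnK// lt0n.
by rewrite subn0 addn0.
Qed.

Lemma mono_up_neq0 k g : mono_up k g k != 0%N.
Proof. by rewrite ffunE eqxx addn1. Qed.

Definition sqterm f (gS : mono m * {set 'I_m}) : R :=
  cnorm (f gS.1 gS.2) ^+ 2 * weight q gS.1.

Lemma sqterm_ge0 f gS : 0 <= sqterm f gS.
Proof. by rewrite mulr_ge0 ?sqr_ge0 ?ltW ?weight_gt0. Qed.

Lemma sqnormE f : sqnorm q f = \esum_(gS in [set: _]) (sqterm f gS)%:E.
Proof. by rewrite /sqnorm; apply: eq_esum => gS _; rewrite -cnorm_sqr. Qed.

Lemma HqP f : Hq q f <-> exists M, bsum (sqterm f) M.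
Proof.
rewrite /Hq /= sqnormE; split=> [foo|[M fM]].
  by eexists; apply: esum_lty_bsum foo => gS; exact: sqterm_ge0.
by apply: le_lt_trans (esum_le_bsum _ _ fM) _; rewrite ltry.
Qed.

Lemma inner_csummable f h : Hq q f -> Hq q h ->
  csummable (fun gS : mono m * {set 'I_m} =>
    f gS.1 gS.2 * (h gS.1 gS.2)^* * (weight q gS.1)%:C).
Proof.
move=> /HqP[M fM] /HqP[N hN].
apply: (csummable_le _ _ _ _ (bsumD _ _ _ _ fM hN)) => gS.
have w0 := ltW (weight_gt0 gS.1).
rewrite !cnormM cnorm_conj cnorm_real ger0_norm// /sqterm -mulrDl ler_wpM2r//.
set x := cnorm _; set y := cnorm _.
have : 0 <= (x - y) ^+ 2 := sqr_ge0 _.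
have : 0 <= x * y by rewrite mulr_ge0 ?cnorm_ge0.
by rewrite sqrrB; lra.
Qed.

Lemma Hq0 : Hq q (0 : fseries R m).
Proof.
apply/HqP; exists 0 => F; rewrite big1// => gS _.
by rewrite /sqterm (_ : (0 : fseries R m) _ _ = 0)// cnorm0 expr0n mul0r.
Qed.

Lemma Hq_lin a f h : Hq q f -> Hq q h -> Hq q (a *: f + h).
Proof.
move=> /HqP[M fM] /HqP[N hN]; apply/HqP; eexists.
have c0 : 0 <= 2 * cnorm a ^+ 2 by rewrite mulr_ge0 ?sqr_ge0.
apply: bsum_le (bsumD _ _ _ _ (bsumZ _ _ _ c0 fM) (bsumZ _ _ _ (ler0n _ 2) hN)).
move=> gS; rewrite /sqterm.
rewrite (_ : (a *: f + h) _ _ = a * f gS.1 gS.2 + h gS.1 gS.2)//.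
set x := f _ _; set y := h _ _; have w0 := ltW (weight_gt0 gS.1).
have le2 : cnorm (a * x + y) ^+ 2 <= 2 * cnorm (a * x) ^+ 2 + 2 * cnorm y ^+ 2.
  apply: (@le_trans _ _ ((cnorm (a * x) + cnorm y) ^+ 2)).
    by rewrite ler_sqr ?nnegrE ?addr_ge0 ?cnorm_ge0// cnormD.
  by have := sqr_ge0 (cnorm (a * x) - cnorm y); rewrite sqrrB sqrrD; lra.
apply: le_trans (ler_wpM2r w0 le2) _; rewrite cnormM le_eqVlt; apply/orP; left.
by apply/eqP; ring.
Qed.

Lemma inner_lin a f h (k : fseries R m) : Hq q f -> Hq q h -> Hq q k ->
  inner q (a *: f + h) k = a * inner q f k + inner q h k.
Proof.
move=> Hf Hh Hk; have fk := inner_csummable _ _ Hf Hk.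
rewrite /inner -csumZ// -csumD//; [|exact: csummableZ|exact: inner_csummable].
congr csum; apply/funext => gS.
rewrite (_ : (a *: f + h) _ _ = a * f gS.1 gS.2 + h gS.1 gS.2)//.
by rewrite !mulrDl !mulrA.
Qed.

Lemma inner_conj f h : Hq q f -> Hq q h -> inner q h f = (inner q f h)^*.
Proof.
move=> Hf Hh; rewrite /inner -csum_conj; last exact: inner_csummable.
congr csum; apply/funext => gS.
by rewrite !numconjE !conjcM conjcK conjc_real [conjc _ * _]mulrC.
Qed.

Lemma inner_self f : inner q f f = (fine (sqnorm q f))%:C.
Proof.
rewrite sqnormE -csum_ge0; last exact: sqterm_ge0.
congr csum; apply/funext => gS.
by rewrite -sqr_normc -cnormC /sqterm rmorphM rmorphXn.
Qed.

Lemma sqn_bsum f : Hq q f -> bsum (sqterm f) (complex.Re (inner q f f)).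
Proof.
move=> Hf; rewrite inner_self sqnormE /=; apply: esum_lty_bsum => [gS|].
  exact: sqterm_ge0.
by rewrite -sqnormE.
Qed.

Lemma sqn_le f M : bsum (sqterm f) M -> complex.Re (inner q f f) <= M.
Proof.
move=> fM; rewrite inner_self sqnormE /=.
rewrite -lee_fin (esum_fineK _ _ _ fM); first exact: esum_le_bsum.
exact: sqterm_ge0.
Qed.

Lemma sqterm_le f gS M : bsum (sqterm f) M -> sqterm f gS <= M.
Proof. by move=> /(_ [fset gS]%fset); rewrite big_seq_fset1. Qed.

Lemma cnorm_sqrE (z : R[i]) : cnorm z ^+ 2 = complex.Re z ^+ 2 + complex.Im z ^+ 2.
Proof. by rewrite cnorm_sqr -add_Re2_Im2. Qed.

Lemma real_cauchy_cvg (x : nat -> R) :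
  (forall e, 0 < e -> exists N, forall i j, (N <= i)%N -> (N <= j)%N -> `|x i - x j| <= e) ->
  x n @[n --> \oo] --> lim (x n @[n --> \oo]).
Proof.
move=> xC; suff : cvg (x n @[n --> \oo]) by [].
apply: cauchy_cvg; apply: cauchy_exP => e e0.
have e2 : 0 < e / 2 by lra.
have [N NP] := xC _ e2; exists (x N), N => // n /= Nn.
by rewrite /ball/=; have := NP N n (leqnn N) Nn; lra.
Qed.

(** The usual argument for weighted $\ell^2$: each coefficient is controlled by the norm, so
    coefficients converge, and the Cauchy estimate survives the coefficientwise limit. *)
Lemma Hq_complete (u : nat -> fseries R m) : (forall n, Hq q (u n)) ->
  (forall e : R, 0 < e -> exists N, forall i j, (N <= i)%N -> (N <= j)%N ->
     complex.Re (inner q (u i - u j) (u i - u j)) <= e) ->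
  exists2 l, Hq q l &
    complex.Re (inner q (u n - l) (u n - l)) @[n --> \oo] --> (0 : R).
Proof.
move=> Hu uC.
have HB f h : Hq q f -> Hq q h -> Hq q (f - h).
  by move=> Hf Hh; rewrite addrC -scaleN1r; exact: Hq_lin.
have coefC g S e : 0 < e -> exists N, forall i j, (N <= i)%N -> (N <= j)%N ->
    cnorm (u i g S - u j g S) <= e.
  move=> e0; have w0 := weight_gt0 g.
  have e1 : 0 < e ^+ 2 * weight q g by rewrite mulr_gt0// exprn_gt0.
  have [N NP] := uC _ e1; exists N => i j Ni Nj.
  have := sqterm_le _ (g, S) _ (sqn_bsum _ (HB _ _ (Hu i) (Hu j))).
  move=> /le_trans/(_ (NP _ _ Ni Nj)); rewrite /sqterm ler_pM2r//.
  by rewrite ler_sqr ?nnegrE ?cnorm_ge0 ?(ltW e0).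
pose l : fseries R m := fun g S =>
  lim (complex.Re (u n g S) @[n --> \oo]) +i* lim (complex.Im (u n g S) @[n --> \oo]).
have lRe g S : complex.Re (u n g S) @[n --> \oo] --> complex.Re (l g S).
  apply: real_cauchy_cvg => e /(coefC g S)[N NP]; exists N => i j Ni Nj.
  by rewrite -raddfB; apply: le_trans (NP _ _ Ni Nj); exact: cnorm_Re.
have lIm g S : complex.Im (u n g S) @[n --> \oo] --> complex.Im (l g S).
  apply: real_cauchy_cvg => e /(coefC g S)[N NP]; exists N => i j Ni Nj.
  by rewrite -raddfB; apply: le_trans (NP _ _ Ni Nj); exact: cnorm_Im.
have ReB (z w : R[i]) : complex.Re (z - w) = complex.Re z - complex.Re w.
  by case: z w => [? ?] [].
have ImB (z w : R[i]) : complex.Im (z - w) = complex.Im z - complex.Im w.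
  by case: z w => [? ?] [].
(* A Fatou argument: over a fixed finite set, the sum for [u n - l] is the limit in [j] of the sums
   for [u n - u j], all at most [e]; [N] does not depend on the finite set. *)
have key e : 0 < e -> exists N, forall n, (N <= n)%N -> bsum (sqterm (u n - l)) e.
  move=> e0; have [N NP] := uC _ e0; exists N => n Nn F.
  have dRe g S : complex.Re ((u n - u j) g S) @[j --> \oo] -->
      complex.Re ((u n - l) g S).
    rewrite [X in _ --> X](_ : _ = complex.Re (u n g S) - complex.Re (l g S)).
      under eq_fun do rewrite (ReB (u n g S)).
      by apply: cvgB; [exact: cvg_cst|exact: lRe].
    exact: ReB.
  have dIm g S : complex.Im ((u n - u j) g S) @[j --> \oo] -->
      complex.Im ((u n - l) g S).
    rewrite [X in _ --> X](_ : _ = complex.Im (u n g S) - complex.Im (l g S)).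
      under eq_fun do rewrite (ImB (u n g S)).
      by apply: cvgB; [exact: cvg_cst|exact: lIm].
    exact: ImB.
  have cvg_sqr (x : nat -> R) (y : R) : x j @[j --> \oo] --> y ->
      x j ^+ 2 @[j --> \oo] --> y ^+ 2.
    by move=> xy; rewrite expr2; under eq_fun do rewrite expr2; exact: cvgM.
  have cF : \sum_(gS <- F) sqterm (u n - u j) gS @[j --> \oo] -->
      \sum_(gS <- F) sqterm (u n - l) gS.
    elim: (enum_fset F) => [|gS r IH].
      by rewrite big_nil; under eq_fun do rewrite big_nil; exact: cvg_cst.
    rewrite big_cons; under eq_fun do rewrite big_cons.
    apply: cvgD IH.
    rewrite /sqterm; apply: cvgMr_tmp.
    rewrite !cnorm_sqrE; under eq_fun do rewrite cnorm_sqrE.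
    by apply: cvgD; apply: cvg_sqr.
  rewrite -(cvg_lim _ cF)//; apply: limr_le; first by apply/cvg_ex; eexists; exact: cF.
  exists N => // j /= Nj; apply: le_trans (NP _ _ Nn Nj).
  exact/sqn_bsum/HB.
have Hd n : Hq q (u n - l) -> Hq q l.
  by move=> Hn; rewrite -[l](subKr (u n)) ; exact: HB.
exists l.
  have [N NP] := key _ ltr01; apply: (Hd N); apply/HqP; exists 1; exact: NP.
apply/cvgrPdist_le => e e0; have [N NP] := key _ e0; exists N => // n /= /NP h.
rewrite sub0r normrN ger0_norm; first exact: sqn_le.
(* The bound at the empty set is nonnegativity of the squared norm. *)
by apply: le_trans (sqn_bsum _ _ fset0); rewrite ?big_seq_fset0//; apply/HqP; exists e.
Qed.

Lemma Hq_hilbert : hilbert (@Hq R m q) (inner q).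
Proof.
split.
- exact: Hq0.
- exact: Hq_lin.
- exact: inner_lin.
- exact: inner_conj.
- move=> f Hf; rewrite inner_self ler0c fine_ge0// sqnormE esum_ge0// => gS _.
  by rewrite lee_fin sqterm_ge0.
- move=> f Hf f0; apply/funext => g; apply/funext => S.
  have := sqterm_le _ (g, S) _ (sqn_bsum _ Hf); rewrite f0 /sqterm/=.
  rewrite pmulr_lle0 ?weight_gt0// => c0; apply: cnorm_eq0.
  by apply/eqP; rewrite -[_ == _](expf_eq0 _ 2) eq_le c0 sqr_ge0.
- exact: Hq_complete.
Qed.

(** Boundedness criterion for operators whose output coefficient at an index depends on a single
    input coefficient, at the index [phi]; all elementary building blocks are of this kind. *)
Lemma Hq_inj f h (phi psi : mono m * {set 'I_m} -> mono m * {set 'I_m}) (c : R) :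
  0 <= c ->
  (forall gS, f gS.1 gS.2 != 0 ->
     sqterm f gS <= c * sqterm h (phi gS) /\ psi (phi gS) = gS) ->
  Hq q h -> Hq q f.
Proof.
move=> c0 fh /HqP[M hM]; apply/HqP; exists (c * M).
apply: (bsum_inj _ _ phi psi _ _ c0 _ _ _ hM) => [gS|gS|gS]; try exact: sqterm_ge0.
move=> f0; apply: fh; apply: contraNneq f0 => f0.
by rewrite /sqterm f0 cnorm0 expr0n mul0r.
Qed.

(** Squaring produces two factors $[g_k+1]_q$; the weight of the raised monomial absorbs one, and
    the other is at most $(1-q)^{-1}$. *)
Lemma Hq_qdiff k f : Hq q f -> Hq q (qdiff q k f).
Proof.
have c0 : 0 <= (1 - q)^-1 by rewrite invr_ge0 subr_ge0 ltW.
apply: (Hq_inj _ _ (fun gS => (mono_up k gS.1, gS.2))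
  (fun gS => (mono_down k gS.1, gS.2)) _ c0) => -[g S] /= _.
rewrite mono_upK; split => //; rewrite /sqterm/= qdiffE weight_up cnormM.
rewrite cnorm_real ger0_norm ?qint_ge0// exprMn.
set x := qint _ _; set y := cnorm _ ^+ 2; set w := weight _ _.
rewrite [leLHS](_ : _ = x * (y * (w * x))); last by rewrite expr2; ring.
apply: ler_wpM2r; last exact: qint_le.
by rewrite mulr_ge0 ?sqr_ge0// mulr_ge0 ?qint_ge0// ltW// weight_gt0.
Qed.

Lemma Hq_mulvar k f : Hq q f -> Hq q (mulvar k f).
Proof.
have c0 : 0 <= (1 - q)^-1 by rewrite invr_ge0 subr_ge0 ltW.
apply: (Hq_inj _ _ (fun gS => (mono_down k gS.1, gS.2))
  (fun gS => (mono_up k gS.1, gS.2)) _ c0) => -[g S] /=.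
rewrite /sqterm /mulvar /=; have [gk|gk _] := eqVneq (g k) 0%N; first by rewrite eqxx.
rewrite mono_downK//; split => //.
rewrite -{2}(mono_downK _ _ gk) weight_up mulrA mulrC.
apply: ler_wpM2r; last exact: qint_le.
by rewrite mulr_ge0 ?sqr_ge0// ltW// weight_gt0.
Qed.

Lemma wedge_sign_norm (i : 'I_m) S : cnorm (wedge_sign R i S) = 1.
Proof. by rewrite /wedge_sign cnormX cnormN cnorm1 expr1n. Qed.

Lemma wedge_sign_conj (i : 'I_m) S : conjc (wedge_sign R i S) = wedge_sign R i S.
Proof. by rewrite /wedge_sign rmorphXn rmorphN rmorph1. Qed.

Lemma Hq_mulE i f : Hq q f -> Hq q (mulE i f).
Proof.
apply: (Hq_inj _ _ (fun gS => (gS.1, gS.2 :\ i)) (fun gS => (gS.1, i |: gS.2)) _ ler01).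
move=> [g S] /=; rewrite /sqterm /mulE /ext_mul /=; case: ifPn => iS; last by rewrite eqxx.
by rewrite mul1r cnormM wedge_sign_norm mul1r finset.setD1K.
Qed.

Lemma Hq_contractE i f : Hq q f -> Hq q (contractE i f).
Proof.
apply: (Hq_inj _ _ (fun gS => (gS.1, i |: gS.2)) (fun gS => (gS.1, gS.2 :\ i)) _ ler01).
move=> [g S] /=; rewrite /sqterm /contractE /ext_contract /=.
case: ifPn => iS; first by rewrite eqxx.
by rewrite mul1r cnormM wedge_sign_norm mul1r finset.setU1K.
Qed.

(** Both sides pair the coefficient of [f] at [mono_up k g] with that of [h] at [g]; the factor
    $[g_k+1]_q$ from the $q$-difference is exactly the ratio of the two weights. *)
Lemma inner_qdiff k f h : inner q (qdiff q k f) h = inner q f (mulvar k h).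
Proof.
apply: (csum_reindex (fun gS => (mono_up k gS.1, gS.2)) (fun gS => (mono_down k gS.1, gS.2)))
  => -[g S] /=; rewrite qdiffE /mulvar.
  rewrite ifN ?mono_up_neq0// mono_upK weight_up (rcM (weight q g)) => _; split => //.
  by ring.
have [gk|gk _] := eqVneq (g k) 0%N; first by rewrite numconjE conjc0 mulr0 mul0r eqxx.
rewrite mono_downK//; split => //.
rewrite (_ : weight q g = weight q (mono_down k g) * qint q (mono_down k g k).+1).
  by rewrite (rcM (weight _ _)); ring.
by rewrite -weight_up mono_downK.
Qed.

Lemma inner_mulE i f h : inner q (mulE i f) h = inner q f (contractE i h).
Proof.
apply: (csum_reindex (fun gS => (gS.1, gS.2 :\ i)) (fun gS => (gS.1, i |: gS.2)))
  => -[g S] /=; rewrite /mulE /contractE /ext_mul /ext_contract !inE eqxx/=.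
  case: ifPn => iS; last by rewrite !mul0r eqxx.
  rewrite finset.setD1K// !numconjE conjcM wedge_sign_conj => _; split => //; ring.
case: ifPn => iS; first by rewrite numconjE conjc0 mulr0 mul0r eqxx.
rewrite finset.setU1K// !numconjE conjcM wedge_sign_conj => _; split => //; ring.
Qed.

Lemma inner_contractE i f h : Hq q f -> Hq q h ->
  inner q (contractE i f) h = inner q f (mulE i h).
Proof.
move=> Hf Hh; rewrite inner_conj//; last exact: Hq_contractE.
by rewrite -inner_mulE -inner_conj//; exact: Hq_mulE.
Qed.

Lemma Hq_sum (I : Type) (r : seq I) (F : I -> fseries R m) :
  (forall i, Hq q (F i)) -> Hq q (\sum_(i <- r) F i).
Proof.
move=> HF; elim/big_ind: _ => //; first exact: Hq0.
by move=> ? ?; exact: hilD Hq_hilbert _ _.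
Qed.

Lemma inner_suml (I : Type) (r : seq I) (F : I -> fseries R m) h :
  (forall i, Hq q (F i)) -> Hq q h ->
  inner q (\sum_(i <- r) F i) h = \sum_(i <- r) inner q (F i) h.
Proof.
move=> HF Hh; elim: r => [|i r IH]; first by rewrite !big_nil (ip0l Hq_hilbert).
by rewrite !big_cons (ipDl Hq_hilbert) ?IH//; exact: Hq_sum.
Qed.

Lemma inner_sumr (I : Type) (r : seq I) (F : I -> fseries R m) h :
  (forall i, Hq q (F i)) -> Hq q h ->
  inner q h (\sum_(i <- r) F i) = \sum_(i <- r) inner q h (F i).
Proof.
move=> HF Hh; rewrite inner_conj//; last exact: Hq_sum.
rewrite inner_suml// rmorph_sum; apply: eq_bigr => i _.
by rewrite [RHS]inner_conj.
Qed.

Lemma Hq_Dop f : Hq q f -> Hq q (Dop q f).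
Proof. by move=> Hf; apply: Hq_sum => i; exact/Hq_mulE/Hq_qdiff. Qed.

Lemma Hq_Zop f : Hq q f -> Hq q (Zop f).
Proof. by move=> Hf; apply: Hq_sum => i; exact/Hq_contractE/Hq_mulvar. Qed.

Lemma Hq_Ddag f : Hq q f -> Hq q (Ddag q f).
Proof. by move=> Hf; apply: Hq_sum => i; exact/Hq_contractE/Hq_qdiff. Qed.

Lemma Hq_Zdag f : Hq q f -> Hq q (Zdag f).
Proof. by move=> Hf; apply: Hq_sum => i; exact/Hq_mulE/Hq_mulvar. Qed.

Lemma inner_Dop f h : Hq q f -> Hq q h -> inner q (Dop q f) h = inner q f (Zop h).
Proof.
move=> Hf Hh; rewrite inner_suml ?inner_sumr//.
- by apply: eq_bigr => i _; rewrite inner_mulE inner_qdiff contractE_mulvar.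
- by move=> i; exact/Hq_contractE/Hq_mulvar.
- by move=> i; exact/Hq_mulE/Hq_qdiff.
Qed.

Lemma inner_Ddag f h : Hq q f -> Hq q h -> inner q (Ddag q f) h = inner q f (Zdag h).
Proof.
move=> Hf Hh; rewrite inner_suml ?inner_sumr//.
- apply: eq_bigr => i _; rewrite inner_contractE//; last exact: Hq_qdiff.
  by rewrite inner_qdiff mulE_mulvar.
- by move=> i; exact/Hq_mulE/Hq_mulvar.
- by move=> i; exact/Hq_contractE/Hq_qdiff.
Qed.

End FockSpace.

Arguments sqterm {R m} q f gS.

(** * The projectors Pi_z and Pi_w *)

Section Projectors.
Context {R : realType} {m : nat} {q : R}.
Hypotheses (q0 : 0 < q) (q1 : q < 1).
Implicit Types (f h : fseries R m) (g : mono m) (S : {set 'I_m}) (v : ext R m).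

(** For distinct [i] and [j] in [S], deleting one changes the sign attached to the other only if the
    deleted index is the smaller one. Exactly one of the two orders therefore picks up a minus
    sign. *)
Lemma ext_mul_anti i j v : ext_mul i (ext_mul j v) = - ext_mul j (ext_mul i v).
Proof.
apply/funext => S; rewrite [RHS](_ : _ = - (ext_mul j (ext_mul i v) S))//.
rewrite /ext_mul !inE; case: (boolP (i \in S)) => iS; last first.
  by rewrite andbF mulr0 if_same oppr0.
case: (boolP (j \in S)) => jS; last by rewrite andbF mulr0 oppr0.
have [->|ij] := eqVneq i j; first by rewrite /= mulr0 oppr0.
have ij' : (i < j)%N != (j < i)%N.
  by move: ij; rewrite neq_ltn; case: (ltngtP i j).
rewrite /=.
have eX : S :\ j :\ i = S :\ i :\ j by apply/setP => l; rewrite !inE andbCA.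
rewrite eX (@wedge_signD1 R m i j) ?inE 1?eq_sym ?ij//.
rewrite (@wedge_signD1 R m j i (S :\ j)) ?inE ?ij// eX.
move: ij'; case: (j < i)%N; case: (i < j)%N => //= _; rewrite ?expr0 ?expr1; ring.
Qed.

Lemma ext_contract_anti i j v :
  ext_contract i (ext_contract j v) = - ext_contract j (ext_contract i v).
Proof.
apply/funext => S; rewrite [RHS](_ : _ = - (ext_contract j (ext_contract i v) S))//.
rewrite /ext_contract !inE; case: (boolP (i \in S)) => iS.
  by rewrite orbT mulr0 if_same oppr0.
case: (boolP (j \in S)) => jS; first by rewrite orbT mulr0 oppr0.
have [->|ij] := eqVneq i j; first by rewrite /= mulr0 oppr0.
have ij' : (i < j)%N != (j < i)%N.
  by move: ij; rewrite neq_ltn; case: (ltngtP i j).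
rewrite /=.
have eX : i |: (j |: S) = j |: (i |: S) by rewrite finset.setUCA.
rewrite eX (@wedge_signD1 R m j i (i |: S)) ?finset.setU11// finset.setU1K//.
rewrite (@wedge_signD1 R m i j (j |: S)) ?finset.setU11// finset.setU1K//.
move: ij'; case: (j < i)%N; case: (i < j)%N => //= _; rewrite ?expr0 ?expr1; ring.
Qed.

Lemma qdiffC k l f : qdiff q k (qdiff q l f) = qdiff q l (qdiff q k f).
Proof.
apply/funext => g; apply/funext => S; rewrite !qdiffE !ffunE.
have [->//|kl] := eqVneq k l; rewrite !addn0 mulrCA.
congr (_ * (_ * f _ S)); apply/ffunP => j; rewrite !ffunE.
by rewrite addnAC.
Qed.

Lemma fseries_sum_anti (F : 'I_m -> 'I_m -> fseries R m) :
  (forall i j, F i j = - F j i) -> \sum_i \sum_j F i j = 0.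
Proof.
move=> Fanti; set s := (X in X = _).
have sN : s = - s.
  rewrite {1}/s exchange_big -sumrN; apply: eq_bigr => i _.
  by rewrite -sumrN; apply: eq_bigr => j _.
(* From $s=-s$ one concludes on coefficients, where $2$ is invertible. *)
apply/funext => g; apply/funext => S.
have : s g S = - s g S by rewrite {1}sN.
move/eqP; rewrite -subr_eq0 opprK -mulr2n mulrn_eq0/= => /eqP; exact.
Qed.

(** As for the exterior derivative: $q$-differences commute while exterior multiplications
    anticommute, so the double sum is antisymmetric. *)
Lemma Dop_sqr f : Dop q (Dop q f) = 0.
Proof.
have -> : Dop q (Dop q f) =
    \sum_i \sum_j mulE i (mulE j (qdiff q (inl i) (qdiff q (inl j) f))).
  apply: eq_bigr => i _; rewrite (morph_sum _ (qdiffD _ _)) (morph_sum _ (mulED _)).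
  by apply: eq_bigr => j _; rewrite -mulE_qdiff.
apply: fseries_sum_anti => i j; rewrite qdiffC; apply/funext => g.
exact: ext_mul_anti.
Qed.

Lemma Ddag_sqr f : Ddag q (Ddag q f) = 0.
Proof.
have -> : Ddag q (Ddag q f) = \sum_i \sum_j
    contractE i (contractE j (qdiff q (inr i) (qdiff q (inr j) f))).
  apply: eq_bigr => i _; rewrite (morph_sum _ (qdiffD _ _)) (morph_sum _ (contractED _)).
  by apply: eq_bigr => j _; rewrite -contractE_qdiff.
apply: fseries_sum_anti => i j; rewrite qdiffC; apply/funext => g.
exact: ext_contract_anti.
Qed.

Lemma DopD : {morph @Dop R m q : f h / f + h}.
Proof.
move=> f h; rewrite /Dop -big_split; apply: eq_bigr => i _.
by rewrite qdiffD mulED.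
Qed.

Lemma DdagD : {morph @Ddag R m q : f h / f + h}.
Proof.
move=> f h; rewrite /Ddag -big_split; apply: eq_bigr => i _.
by rewrite qdiffD contractED.
Qed.

Lemma DopE f g S : Dop q f g S = \sum_(i in S)
  wedge_sign R i (S :\ i) * ((qint q (g (inl i)).+1)%:C * f (mono_up (inl i) g) (S :\ i)).
Proof.
rewrite /Dop !fct_sumE [RHS]big_mkcond; apply: eq_bigr => i _.
by rewrite /mulE /ext_mul qdiffE.
Qed.

Lemma DdagE f g S : Ddag q f g S = \sum_(i | i \notin S)
  wedge_sign R i S * ((qint q (g (inr i)).+1)%:C * f (mono_up (inr i) g) (i |: S)).
Proof.
rewrite /Ddag !fct_sumE [RHS]big_mkcond; apply: eq_bigr => i _.
by rewrite /contractE /ext_contract qdiffE; case: ifP.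
Qed.

Lemma DopZ a f : Dop q (a *: f) = a *: Dop q f.
Proof.
apply/funext => g; apply/funext => S.
rewrite [RHS](_ : _ = a * Dop q f g S)// !DopE mulr_sumr; apply: eq_bigr => i _.
rewrite (_ : (a *: f) _ _ = a * f (mono_up (inl i) g) (S :\ i))//; ring.
Qed.

Lemma DdagZ a f : Ddag q (a *: f) = a *: Ddag q f.
Proof.
apply/funext => g; apply/funext => S.
rewrite [RHS](_ : _ = a * Ddag q f g S)// !DdagE mulr_sumr; apply: eq_bigr => i _.
rewrite (_ : (a *: f) _ _ = a * f (mono_up (inr i) g) (i |: S))//; ring.
Qed.

Definition eigA g S : R := \sum_i qint q (g (inl i) + (i \in S)).
Definition eigB g S : R := \sum_i qint q (g (inr i) + (i \notin S)).

Lemma AsharpE f g S : Asharp q f g S = ((eigA g S)%:C)^-1 * f g S.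
Proof.
by rewrite /Asharp /diag_pinv AopE /Defs.basis !eqxx mulr1.
Qed.

Lemma BsharpE f g S : Bsharp q f g S = ((eigB g S)%:C)^-1 * f g S.
Proof.
by rewrite /Bsharp /diag_pinv BopE /Defs.basis !eqxx mulr1.
Qed.

(** Each term of $D_q$ trades one power of $z_i$ for the factor $e_i$, which preserves every
    $\alpha_j+\mathbf 1_{j\in S}$ and hence the eigenvalue of $A_q$. *)
Lemma Dop_Asharp f : Dop q (Asharp q f) = Asharp q (Dop q f).
Proof.
apply/funext => g; apply/funext => S.
rewrite AsharpE !DopE mulr_sumr; apply: eq_bigr => i iS.
rewrite AsharpE (_ : eigA (mono_up (inl i) g) (S :\ i) = eigA g S); first by ring.
apply: eq_bigr => j _; congr (qint q _); rewrite !ffunE !inE.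
rewrite (_ : (inl j == inl i) = (j == i))//.
by have [->|] := eqVneq j i; rewrite ?iS ?addn0 ?addn1.
Qed.

Lemma Ddag_Bsharp f : Ddag q (Bsharp q f) = Bsharp q (Ddag q f).
Proof.
apply/funext => g; apply/funext => S.
rewrite BsharpE !DdagE mulr_sumr; apply: eq_bigr => i iS.
rewrite BsharpE (_ : eigB (mono_up (inr i) g) (i |: S) = eigB g S); first by ring.
apply: eq_bigr => j _; congr (qint q _); rewrite !ffunE !inE.
rewrite (_ : (inr j == inr i) = (j == i))//.
by have [->|] := eqVneq j i; rewrite ?iS ?addn0 ?addn1.
Qed.

(** The spectral gap: an eigenvalue of $A_q$ or $B_q$ is zero, with all its indices zero, or at
    least 1. *)
Lemma sum_qint_cases (n : 'I_m -> nat) :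
  (forall i, n i = 0%N) \/ 1 <= \sum_i qint q (n i).
Proof.
have [/existsP[i ni]|/existsPn h] := boolP [exists i, n i != 0%N]; [right|left].
  rewrite (bigD1 i)//= -[X in X <= _]addr0 lerD//.
    by case: (n i) ni => // k _; exact: qint_ge1.
  by rewrite sumr_ge0// => j _; exact: qint_ge0.
by move=> i; have := h i; rewrite negbK => /eqP.
Qed.

(** Eigenvalue zero forces [S] to be empty, and every coefficient produced by $D_q$ sits at a
    nonempty [S]. *)
Lemma Dop_eigA0 f g S : eigA g S = 0 -> Dop q f g S = 0.
Proof.
move=> eig0; rewrite DopE big1// => i iS.
have [/(_ i)|] := sum_qint_cases (fun i => g (inl i) + (i \in S))%N.
  by rewrite iS addn1.
by rewrite -/(eigA g S) eig0 ler10.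
Qed.

Lemma Ddag_eigB0 f g S : eigB g S = 0 -> Ddag q f g S = 0.
Proof.
move=> eig0; rewrite DdagE big1// => i iS.
have [/(_ i)|] := sum_qint_cases (fun i => g (inr i) + (i \notin S))%N.
  by rewrite iS addn1.
by rewrite -/(eigB g S) eig0 ler10.
Qed.

Lemma Hq_diag (c : mono m -> {set 'I_m} -> R) f :
  (forall g S, c g S = 0 \/ 1 <= c g S) -> Hq q f ->
  Hq q (fun g S => ((c g S)%:C)^-1 * f g S).
Proof.
move=> c1; apply: (@Hq_inj _ _ _ q0 q1 _ _ id id _ ler01) => -[g S] /= _.
split => //; rewrite mul1r /sqterm/= ler_wpM2r ?(ltW (weight_gt0 q0 q1 _))//.
rewrite cnormM exprMn ler_piMl ?sqr_ge0// exprn_ile1 ?cnorm_ge0//.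
rewrite cnormV cnorm_real; have [->|c1'] := c1 g S; first by rewrite normr0 invr0.
by rewrite ger0_norm ?invf_le1 ?(lt_le_trans ltr01)// (le_trans ler01).
Qed.

Lemma Hq_Asharp f : Hq q f -> Hq q (Asharp q f).
Proof.
move=> Hf; rewrite (_ : Asharp q f = fun g S => ((eigA g S)%:C)^-1 * f g S).
  apply: Hq_diag => // g S; rewrite /eigA.
  have [h|] := sum_qint_cases (fun i => g (inl i) + (i \in S))%N; [left|by right].
  by rewrite big1// => i _; rewrite h qint0.
by apply/funext => g; apply/funext => S; rewrite AsharpE.
Qed.

Lemma Hq_Bsharp f : Hq q f -> Hq q (Bsharp q f).
Proof.
move=> Hf; rewrite (_ : Bsharp q f = fun g S => ((eigB g S)%:C)^-1 * f g S).
  apply: Hq_diag => // g S; rewrite /eigB.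
  have [h|] := sum_qint_cases (fun i => g (inr i) + (i \notin S))%N; [left|by right].
  by rewrite big1// => i _; rewrite h qint0.
by apply/funext => g; apply/funext => S; rewrite BsharpE.
Qed.

(* D Z = A - Z D and D^2 = 0 give D (I - Z A^# D) = D - A A^# D, which vanishes
   since the range of D meets no zero eigenvalue of A. *)
Lemma ker_orthproj (D Z L : fseries R m -> fseries R m)
    (lam : mono m -> {set 'I_m} -> R) :
  {morph D : f h / f + h} -> (forall a f, D (a *: f) = a *: D f) ->
  (forall f, D (D f) = 0) -> (forall f, D (L f) = L (D f)) ->
  (forall f g S, (D (Z f) + Z (D f)) g S = (lam g S)%:C * f g S) ->
  (forall f g S, L f g S = ((lam g S)%:C)^-1 * f g S) ->
  (forall f g S, lam g S = 0 -> D f g S = 0) ->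
  Z 0 = 0 ->
  (forall f, Hq q f -> Hq q (D f)) -> (forall f, Hq q f -> Hq q (Z f)) ->
  (forall f, Hq q f -> Hq q (L f)) ->
  (forall f h, Hq q f -> Hq q h -> inner q (D f) h = inner q f (Z h)) ->
  orthproj (Hq q) (inner q) [set f | Hq q f /\ D f = 0] (fun f => f - Z (L (D f))).
Proof.
move=> DD DZ D2 DL A LE lam0 Z0 HD HZ HL adj.
have D0 : D 0 = 0 by rewrite -[X in D X](scale0r 0) DZ scale0r.
have hH := @Hq_hilbert R m q q0 q1.
have HB := hilB hH.
split=> [f []//| |a f h [Hf Df] [Hh Dh]|f Hf].
- by split => //; exact: hil0 hH.
- split; first exact: (hilP hH).
  by rewrite DD DZ Df Dh scaler0 addr0.
- have HZf : Hq q (Z (L (D f))) by apply/HZ/HL/HD.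
  split; last first.
    move=> h [Hh Dh]; rewrite opprB addrC subrK.
    rewrite (hilC hH)// -adj//; last exact/HL/HD.
    by rewrite Dh (ip0l hH) ?conjc0//; exact/HL/HD.
  split; first exact: HB.
  rewrite DD -scaleN1r DZ scaleN1r; apply/eqP; rewrite subr_eq0; apply/eqP.
  apply/funext => g; apply/funext => S; have := A (L (D f)) g S.
  rewrite DL D2 (_ : L 0 = 0) ?Z0 ?addr0; last first.
    apply/funext => g'; apply/funext => S'; rewrite LE.
    by rewrite (_ : (0 : fseries R m) _ _ = 0)// mulr0.
  move=> ->; rewrite LE; have [l0|l0] := eqVneq (lam g S) 0.
    by rewrite lam0// !mulr0.
  by rewrite mulVKf// eq_complex /= eqxx andbT.
Qed.

Lemma Zop0 : Zop (0 : fseries R m) = 0.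
Proof.
apply: (addrI (Zop 0)); rewrite addr0 -[in RHS](addr0 (0 : fseries R m)).
rewrite /Zop -big_split; apply: eq_bigr => i _.
by rewrite mulvarD contractED.
Qed.

Lemma Zdag0 : Zdag (0 : fseries R m) = 0.
Proof.
apply: (addrI (Zdag 0)); rewrite addr0 -[in RHS](addr0 (0 : fseries R m)).
rewrite /Zdag -big_split; apply: eq_bigr => i _.
by rewrite mulvarD mulED.
Qed.

Lemma Piz_orthproj : orthproj (Hq q) (inner q) (kerD m q) (Piz q).
Proof.
apply: (@ker_orthproj (Dop q) (@Zop R m) (Asharp q) eigA).
- exact: DopD.
- exact: DopZ.
- exact: Dop_sqr.
- exact: Dop_Asharp.
- exact: AopE.
- exact: AsharpE.
- exact: Dop_eigA0.
- exact: Zop0.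
- exact: Hq_Dop.
- exact: Hq_Zop.
- exact: Hq_Asharp.
- by move=> f h Hf Hh; rewrite inner_Dop.
Qed.

Lemma Piw_orthproj : orthproj (Hq q) (inner q) (kerDdag m q) (Piw q).
Proof.
apply: (@ker_orthproj (Ddag q) (@Zdag R m) (Bsharp q) eigB).
- exact: DdagD.
- exact: DdagZ.
- exact: Ddag_sqr.
- exact: Ddag_Bsharp.
- exact: BopE.
- exact: BsharpE.
- exact: Ddag_eigB0.
- exact: Zdag0.
- exact: Hq_Ddag.
- exact: Hq_Zdag.
- exact: Hq_Bsharp.
- by move=> f h Hf Hh; rewrite inner_Ddag.
Qed.

End Projectors.

(** * Evaluation and the kernel sections *)

Section ProductOfSums.
Context {R : realType} {K : finType}.

(** On these cubes a product of partial sums expands exactly by distributivity, and every finite set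
    of multi-indices lies in one of them. *)
Definition box (N : nat) : {fset {ffun K -> nat}} :=
  [fset ([ffun k => nat_of_ord (f k)] : {ffun K -> nat}) | f : {ffun K -> 'I_N} in predT]%fset.

Lemma mem_box N (g : {ffun K -> nat}) : (g \in box N) = [forall k, (g k < N)%N].
Proof.
apply/imfsetP/forallP => [[f _ ->] k|gN]; first by rewrite ffunE.
exists [ffun k => Ordinal (gN k)] => //.
by apply/ffunP => k; rewrite !ffunE.
Qed.

Lemma box_exhaust (F : {fset {ffun K -> nat}}) :
  exists N, forall n, (N <= n)%N -> (F `<=` box n)%fset.
Proof.
exists (\max_(g <- F) \max_k (g k)).+1 => n Nn; apply/fsubsetP => g gF.
rewrite mem_box; apply/forallP => k; apply: leq_trans Nn; rewrite ltnS.
apply: (@leq_trans (\max_k (g k))); first exact: (leq_bigmax k).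
by rewrite (big_fsetD1 g)//= leq_maxl.
Qed.

Lemma sum_box {A : comPzRingType} (u : K -> nat -> A) N :
  \sum_(g <- box N) \prod_k u k (g k) = \prod_k \sum_(i < N) u k i.
Proof.
rewrite big_imfset/= => [|f f' _ _ ff']; last first.
  apply/ffunP => k; apply: val_inj.
  by have := congr1 (fun g : {ffun K -> nat} => g k) ff'; rewrite !ffunE.
rewrite big_enum/= bigA_distr_bigA/=.
by apply: eq_bigr => f _; apply: eq_bigr => k _; rewrite ffunE.
Qed.


Definition ccvg (a : nat -> R[i]) (l : R[i]) : Prop :=
  forall e : R, 0 < e -> exists N, forall n, (N <= n)%N -> cnorm (a n - l) <= e.

Lemma ccvg_unique (a : nat -> R[i]) (k l : R[i]) : ccvg a k -> ccvg a l -> k = l.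
Proof.
move=> ak al; apply/eqP; rewrite -subr_eq0; apply/eqP/cnorm_eq0.
apply/eqP; rewrite eq_le cnorm_ge0 andbT; apply/ler_addgt0Pl => e e0.
have e2 : 0 < e / 2 by lra.
have [N NP] := ak _ e2; have [M MP] := al _ e2.
have h1 := NP _ (leq_maxl N M); have h2 := MP _ (leq_maxr N M).
set x := a _ in h1 h2.
rewrite (_ : k - l = (x - l) - (x - k)); last by ring.
by apply: le_trans (cnormD _ _) _; rewrite cnormN; lra.
Qed.

Lemma ccvgM (a b : nat -> R[i]) (k l : R[i]) : ccvg a k -> ccvg b l ->
  ccvg (fun n => a n * b n) (k * l).
Proof.
move=> ak bl e e0; pose C := 1 + cnorm k + cnorm l.
have [k0 l0] := (cnorm_ge0 k, cnorm_ge0 l).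
have C0 : 0 < C by rewrite /C; lra.
(* With both errors at most [d] and [d <= 1], the three error terms of the product add up to at most
   [d * C]. *)
pose d := Num.min 1 (e / C).
have d0 : 0 < d by rewrite lt_min ltr01 divr_gt0.
have d1 : d <= 1 by rewrite ge_min lexx.
have dC : d * C <= e by rewrite -ler_pdivlMr// ge_min lexx orbT.
have [N NP] := ak _ d0; have [M MP] := bl _ d0.
exists (maxn N M) => n; rewrite geq_max => /andP[/NP h1 /MP h2].
rewrite (_ : a n * b n - k * l =
  (a n - k) * (b n - l) + k * (b n - l) + (a n - k) * l); last by ring.
apply: le_trans (cnormD _ _) _; apply: le_trans (lerD (cnormD _ _) (lexx _)) _.
rewrite !cnormM; set x := cnorm (a n - k) in h1 *; set y := cnorm (b n - l) in h2 *.
have [x0 y0] : 0 <= x /\ 0 <= y by split; exact: cnorm_ge0.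
apply: le_trans dC; rewrite /C.
have : x * y <= d * 1 by rewrite ler_pM// (le_trans h2).
have : cnorm k * y <= cnorm k * d by rewrite ler_wpM2l.
have : x * cnorm l <= d * cnorm l by rewrite ler_wpM2r.
by rewrite !mulrDr [d * cnorm k]mulrC; lra.
Qed.

Lemma ccvg_prod (r : seq K) (a : K -> nat -> R[i]) (l : K -> R[i]) :
  (forall k, ccvg (a k) (l k)) ->
  ccvg (fun n => \prod_(k <- r) a k n) (\prod_(k <- r) l k).
Proof.
move=> al; elim: r => [|k r IH].
  move=> e e0; exists 0%N => n _; rewrite !big_nil subrr cnorm0 ltW//.
rewrite big_cons; under eq_fun do rewrite big_cons.
exact: ccvgM.
Qed.

Lemma has_csum_exhaust {I : choiceType} (u : I -> R[i]) s (B : nat -> {fset I}) :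
  (forall F : {fset I}, exists N, forall n, (N <= n)%N -> (F `<=` B n)%fset) ->
  has_csum u s -> ccvg (fun n => \sum_(i <- B n) u i) s.
Proof.
move=> hB us e /us[F FP]; have [N NP] := hB F.
by exists N => n /NP; exact: FP.
Qed.

Lemma sum_fset_ord {V : nmodType} (u : nat -> V) N :
  \sum_(i <- [fset nat_of_ord i | i in 'I_N]%fset) u i = \sum_(i < N) u i.
Proof. by rewrite big_imfset/= ?big_enum// => i j _ _ /val_inj. Qed.

Lemma ord_exhaust (F : {fset nat}) :
  exists N, forall n, (N <= n)%N -> (F `<=` [fset nat_of_ord i | i in 'I_n])%fset.
Proof.
exists (\max_(i <- F) i).+1 => n Nn; apply/fsubsetP => i iF.
have iN : (i < n)%N.
  by apply: leq_trans Nn; rewrite ltnS (big_fsetD1 i)//= leq_maxl.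
by apply/imfsetP; exists (Ordinal iN).
Qed.

Lemma bsum_prod (a : K -> nat -> R) (M : K -> R) :
  (forall k n, 0 <= a k n) -> (forall k, bsum (a k) (M k)) ->
  bsum (fun g : {ffun K -> nat} => \prod_k a k (g k)) (\prod_k M k).
Proof.
move=> a0 aM F; have [N /(_ _ (leqnn N)) FN] := box_exhaust F.
have p0 (g : {ffun K -> nat}) : 0 <= \prod_k a k (g k) by rewrite prodr_ge0.
apply: le_trans (sum_fset_mono p0 FN) _; rewrite sum_box.
apply: ler_prod => k _; rewrite sumr_ge0//= -sum_fset_ord.
exact: aM.
Qed.

Lemma csummable_prod (u : K -> nat -> R[i]) : (forall k, csummable (u k)) ->
  csummable (fun g : {ffun K -> nat} => \prod_k u k (g k)).
Proof.
move=> su.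
have /choice[M uM] : forall k, exists M, bsum (fun n => cnorm (u k n)) M by exact: su.
exists (\prod_k M k).
have := bsum_prod (fun k n => cnorm (u k n)) M (fun k n => cnorm_ge0 _) uM.
by apply: bsum_le => g; rewrite cnorm_prod.
Qed.

(** Along cubes the multi-index sum equals the product of the one-variable partial sums, so both
    sides are limits of the same sequence. *)
Lemma csum_prod (u : K -> nat -> R[i]) : (forall k, csummable (u k)) ->
  csum (fun g : {ffun K -> nat} => \prod_k u k (g k)) = \prod_k csum (u k).
Proof.
move=> su; have sP := csummable_prod u su.
apply: (ccvg_unique (fun N => \sum_(g <- box N) \prod_k u k (g k))).
  by apply: has_csum_exhaust (csumP _ sP); exact: box_exhaust.
under eq_fun do rewrite sum_box; apply: ccvg_prod => k.
under eq_fun do rewrite -sum_fset_ord.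
by apply: has_csum_exhaust (csumP _ (su k)); exact: ord_exhaust.
Qed.

End ProductOfSums.

(** * Point evaluation on [Omega] and explicit kernel sections *)

Section Evaluation.
Context {R : realType} {m : nat} {q : R}.
Hypotheses (q0 : 0 < q) (q1 : q < 1).
Implicit Types (f h : fseries R m) (g : mono m) (S : {set 'I_m}) (v : ext R m)
  (x y : Defs.cpoint R m).

(* The ratio of consecutive terms, t_(r+1) / t_r = a (1 - q) / (1 - q^(r+1)), is
   eventually at most some rho < 1, and then t_0 + .. + t_(r-1) + t_r / (1 - rho)
   is nonincreasing in r. *)
Lemma qexp_bsum (a : R) : 0 <= a -> a < (1 - q)^-1 ->
  exists M, bsum (fun r => a ^+ r / qfact q r) M.
Proof.
move=> a0 a1; pose t r := a ^+ r / qfact q r.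
have p1 : 0 < 1 - q by rewrite subr_gt0.
have t0 r : 0 <= t r by rewrite divr_ge0 ?exprn_ge0// ltW// qfact_gt0.
pose b := a * (1 - q).
have b0 : 0 <= b by rewrite mulr_ge0// ltW.
have b1 : b < 1 by rewrite /b -ltr_pdivlMr// div1r.
pose rho := (1 + b) / 2.
have [r0 r1 br] : [/\ 0 < rho, rho < 1 & b < rho] by rewrite /rho; split; lra.
(* This is the condition $b/(1-q^n)\le\rho$ on the ratio of consecutive terms, attainable because
   the limit ratio [b] is below the midpoint [rho] of [b] and 1. *)
have [N NP] : exists N, forall n, (N <= n)%N -> q ^+ n <= 1 - b / rho.
  have d0 : 0 < 1 - b / rho by rewrite subr_gt0 ltr_pdivrMr// mul1r.
  have nq : `|q| < 1 by rewrite ger0_norm ?(ltW q0).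
  have /cvgrPdist_le/(_ _ d0)[N _ NP] := cvg_expr nq.
  exists N => n /NP /=; rewrite sub0r normrN ger0_norm// exprn_ge0// ltW//.
have tS r : (N <= r)%N -> t r.+1 <= rho * t r.
  move=> Nr; have Q0 := qint_gt0 q0 q1 r.
  rewrite (_ : t r.+1 = a / qint q r.+1 * t r); last first.
    rewrite /t qfactS exprS; field.
    by rewrite !gt_eqF// qfact_gt0.
  apply: ler_wpM2r => //; rewrite ler_pdivrMr// /qint mulrA ler_pdivlMr// -/b.
  have := NP r.+1 (leqW Nr); rewrite -(ler_pM2l r0) mulrBr mulr1 mulrCA divff ?gt_eqF//.
  by lra.
pose s n := \sum_(i < n) t i.
have sS j : s (N + j)%N + t (N + j)%N / (1 - rho) <= s N + t N / (1 - rho).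
  elim: j => [|j IH]; first by rewrite addn0.
  apply: le_trans IH; rewrite addnS /s big_ord_recr/= -addrA lerD2l.
  have e : t (N + j)%N / (1 - rho) = t (N + j)%N + rho * t (N + j)%N / (1 - rho).
    by field; lra.
  by rewrite e lerD2l ler_wpM2r ?invr_ge0 ?subr_ge0 ?(ltW r1)// tS// leq_addr.
exists (s N + t N / (1 - rho)) => F; have [n nP] := ord_exhaust F.
have {}nP := nP (N + n)%N (leq_addl _ _).
apply: le_trans (sum_fset_mono t0 nP) _; rewrite sum_fset_ord.
apply: le_trans (sS n); rewrite lerDl divr_ge0// ltW//; lra.
Qed.

Definition monom x g : R[i] := \prod_k x k ^+ g k.

Lemma cnorm_Omega x y k : Omega q x -> Omega q y -> cnorm (x k * (y k)^*) < (1 - q)^-1.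
Proof.
move=> /(_ k) + /(_ k); rewrite -!cnormC !ltcR => xk yk.
rewrite cnormM cnorm_conj (_ : _^-1 = (Num.sqrt (1 - q))^-1 * (Num.sqrt (1 - q))^-1).
  by rewrite ltr_pM ?cnorm_ge0.
by rewrite -invfM -expr2 sqr_sqrtr// subr_ge0 ltW.
Qed.

(** The full sum is $\prod_k\mathrm e_q(|x_k|^2)$, the diagonal value of the kernel. It converges
    because the squared radius of [Omega] is the radius of convergence of $\mathrm e_q$. *)
Lemma monom_bsum x : Omega q x ->
  exists M, bsum (fun g => cnorm (monom x g) ^+ 2 / weight q g) M.
Proof.
move=> xO.
have /choice[M MP] : forall k, exists M, bsum (fun r => (cnorm (x k) ^+ 2) ^+ r / qfact q r) M.
  move=> k; apply: qexp_bsum; first by rewrite sqr_ge0.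
  by have := cnorm_Omega x x k xO xO; rewrite cnormM cnorm_conj -expr2.
have t0 k r : 0 <= (cnorm (x k) ^+ 2) ^+ r / qfact q r.
  by rewrite divr_ge0 ?(ltW (qfact_gt0 q0 q1 _))// exprn_ge0// sqr_ge0.
exists (\prod_k M k); have := bsum_prod _ M t0 MP; apply: bsum_le => g.
rewrite /monom cnorm_prod -prodrXl /weight -prodf_div.
apply: ler_prod => k _; rewrite cnormX -!exprM mulnC lexx andbT.
by rewrite divr_ge0 ?(ltW (qfact_gt0 q0 q1 _))// exprn_ge0// cnorm_ge0.
Qed.

Lemma eval_csummable f S x : Hq q f -> Omega q x ->
  csummable (fun g => f g S * monom x g).
Proof.
move=> /(HqP q0 q1)[M fM] /monom_bsum[N xN].
have fS : bsum (fun g => sqterm q f (g, S)) (1 * M).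
  apply: (bsum_inj (fun g => sqterm q f (g, S)) (@sqterm R m q f)
    (fun g : mono m => (g, S)) fst 1 M ler01 _ _ _ fM)
    => [gS|g|g _].
  - exact: sqterm_ge0.
  - exact: sqterm_ge0.
  - by rewrite mul1r.
apply: (csummable_le _ _ _ _ (bsumD _ _ _ _ fS xN)) => g.
rewrite /sqterm/= cnormM; set a := cnorm _; set b := cnorm _.
have w0 := weight_gt0 q0 q1 g; set w := weight _ _ in w0 *.
have a0 : 0 <= a := cnorm_ge0 _; have b0 : 0 <= b := cnorm_ge0 _.
have ab0 : 0 <= a * b by rewrite mulr_ge0.
(* Weighted arithmetic-geometric mean: $2ab\le a^2w+b^2/w$, where the two terms on the right are
   summable by membership in $H_q$ and by [monom_bsum]. *)
have : 0 <= (a * w - b) ^+ 2 / w by rewrite divr_ge0 ?sqr_ge0// ltW.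
rewrite (_ : _ / w = a ^+ 2 * w + b ^+ 2 / w - a * b *+ 2); first by lra.
by field; rewrite gt_eqF.
Qed.

Lemma fs_eval_lin c f h x : Hq q f -> Hq q h -> Omega q x ->
  fs_eval (c *: f + h) x = c *: fs_eval f x + fs_eval h x.
Proof.
move=> Hf Hh xO; apply/funext => S.
rewrite [RHS](_ : _ = c * fs_eval f x S + fs_eval h x S)// /fs_eval.
have sf := eval_csummable f S x Hf xO; have sh := eval_csummable h S x Hh xO.
rewrite -csumZ// -csumD//; last exact: csummableZ.
congr csum; apply/funext => g.
by rewrite (_ : (c *: f + h) g S = c * f g S + h g S)// mulrDl mulrA.
Qed.

(** The power series coefficients of $K_q(\cdot,y)v$. The weight in the denominator cancels the one
    in [inner], so that pairing with this series is evaluation at [y]. *)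
Definition kernel_section y v : fseries R m :=
  fun g S => v S * (conjc (monom y g) / (weight q g)%:C).

Lemma kernel_section_Hq y v : Omega q y -> Hq q (kernel_section y v).
Proof.
move=> /monom_bsum[M yM].
(* The finitely many components along $e_T$ are treated separately, each being dominated by
   [monom_bsum]. *)
pose piece T : fseries R m := fun g S => if S == T then kernel_section y v g S else 0.
have -> : kernel_section y v = \sum_T piece T.
  apply/funext => g; apply/funext => S; rewrite !fct_sumE (bigD1 S)//= /piece eqxx.
  by rewrite big1 ?addr0// => T; rewrite eq_sym => /negbTE ->.
apply: (Hq_sum q0 q1) => T; apply/(HqP q0 q1); exists (cnorm (v T) ^+ 2 * M).
apply: (bsum_inj _ _ fst (fun g => (g, T)) _ _ (sqr_ge0 _) _ _ _ yM) => [g|gS|[g S]].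
- by rewrite divr_ge0 ?sqr_ge0// ltW// weight_gt0.
- exact: sqterm_ge0.
- rewrite /sqterm /piece /=; case: (eqVneq S T) => [->|_]; last first.
    by rewrite cnorm0 expr0n mul0r eqxx.
  move=> _; split => //; rewrite /kernel_section !cnormM cnormV cnorm_conj.
  have w0 := weight_gt0 q0 q1 g.
  rewrite cnorm_real gtr0_norm// le_eqVlt; apply/orP; left; apply/eqP.
  by field; rewrite gt_eqF.
Qed.

Lemma kernel_section_eval y v x : Omega q x -> Omega q y ->
  fs_eval (kernel_section y v) x = Kq q x y v.
Proof.
move=> xO yO; apply/funext => S.
pose u k r := (x k * conjc (y k)) ^+ r / (qfact q r)%:C.
have su k : csummable (u k).
  have [M MP] := qexp_bsum _ (cnorm_ge0 _) (cnorm_Omega x y k xO yO).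
  apply: csummable_le MP => r.
  by rewrite /u cnormM cnormX cnormV cnorm_real gtr0_norm ?qfact_gt0.
rewrite [RHS](_ : _ = (\prod_k csum (u k)) * v S)// -csum_prod// mulrC.
have sP := csummable_prod u su.
rewrite -csumZ//; congr csum; apply/funext => g.
rewrite /kernel_section -mulrA; congr (_ * _).
rewrite mulrAC /u prodf_div; congr (_ / _); last by rewrite /weight rmorph_prod.
rewrite /monom rmorph_prod -big_split; apply: eq_bigr => k _.
by rewrite rmorphXn exprMn mulrC.
Qed.

Lemma kernel_section_inner f y v : Hq q f -> Omega q y ->
  inner q f (kernel_section y v) = ext_ip (fs_eval f y) v.
Proof.
move=> Hf yO; have HK := kernel_section_Hq y v yO.
rewrite /inner csum_pair; last exact: inner_csummable.
apply: eq_bigr => S _ /=; rewrite mulrC -csumZ; last exact: eval_csummable.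
congr csum; apply/funext => g; have w0 := weight_gt0 q0 q1 g.
rewrite /kernel_section !numconjE !conjcM conjcK conjc_inv conjc_real.
rewrite -/(monom y g); field.
by rewrite eq_complex /= eqxx andbT gt_eqF.
Qed.

End Evaluation.

Arguments kernel_section {R m} q y v.

(** * The identity theorem and reproducing kernels *)

Section IdentityTheorem.
Context {R : realType} {m : nat} {q : R}.
Hypotheses (q0 : 0 < q) (q1 : q < 1).
Implicit Types (g : mono m) (k : var m) (x : Defs.cpoint R m) (c : mono m -> R[i]).

Let abs_cvg c := forall x, Omega q x -> csummable (fun g => c g * monom x g).
Let vanishes c := forall x, Omega q x -> csum (fun g => c g * monom x g) = 0.
Let keep (p : pred (mono m)) c : mono m -> R[i] := fun g => if p g then c g else 0.

Let keep_cvg p c : abs_cvg c -> abs_cvg (keep p c).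
Proof.
move=> sc x /sc[M cM]; exists M; apply: bsum_le cM => g.
by rewrite /keep; case: ifP => // _; rewrite mul0r cnorm0 cnorm_ge0.
Qed.

(* Dividing sum_(g k >= n) c_g x^g by t^n after the dilation x_k -> t x_k and
   letting t -> 0 isolates the terms with g k = n. *)
Lemma vanishes_slice c k n : abs_cvg c -> vanishes c ->
  vanishes (keep (fun g => g k == n) c).
Proof.
move=> sc vc; elim/ltn_ind: n => n IH x xO.
pose xt (t : R) : Defs.cpoint R m := fun l => if l == k then t%:C * x l else x l.
have xtO t : 0 <= t -> t <= 1 -> Omega q (xt t).
  move=> t0 t1 l; rewrite /xt; case: eqP => [_|_]; last exact: xO.
  apply: le_lt_trans (xO l); rewrite normrM -!cnormC cnorm_real ger0_norm//.
  by rewrite -rmorphM lecR ler_piMl ?cnorm_ge0.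
have xtE t g : monom (xt t) g = t%:C ^+ g k * monom x g.
  rewrite /monom (bigD1 k)//= [in RHS](bigD1 k)//= /xt eqxx exprMn -mulrA.
  by congr (_ * (_ * _)); apply: eq_bigr => l /negbTE ->.
set A := csum _.
have [M cM] := sc x xO; have M0 := bsum_ge0 _ _ cM.
have Ale t : 0 < t -> t <= 1 -> cnorm A <= t * M.
  move=> t0 t1; have tO := xtO t (ltW t0) t1.
  have sp p : csummable (fun g => keep p c g * monom (xt t) g) := keep_cvg p c sc _ tO.
  (* Split by degree in $x_k$: degrees below [n] vanish by induction, degree [n] gives $t^nA$, and
     higher degrees are at most $t^{n+1}M$ in modulus. *)
  have csplit : csum (fun g => c g * monom (xt t) g) =
      csum (fun g => \sum_(j <- index_enum 'I_n) keep (fun g => g k == j) c g * monom (xt t) g) +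
      (csum (fun g => keep (fun g => g k == n) c g * monom (xt t) g) +
       csum (fun g => keep (fun g => n < g k)%N c g * monom (xt t) g)).
    have [s1 _] := csum_sum (index_enum 'I_n)
      (fun (j : 'I_n) g => keep (fun g => g k == j) c g * monom (xt t) g) (fun j => sp _).
    rewrite -csumD// -csumD//; last exact: csummableD.
    congr csum; apply/funext => g; rewrite -mulr_suml -!mulrDl; congr (_ * _).
    rewrite /keep; case: (ltngtP (g k) n) => gn.
    - rewrite (bigD1 (Ordinal gn))//= eqxx big1 ?addr0// => j.
      by rewrite -val_eqE /= eq_sym => /negbTE ->.
    - rewrite add0r big1 ?add0r// => j _.
      by rewrite gtn_eqF// (ltn_trans (ltn_ord j)).
    - rewrite addr0 big1 ?add0r// => j _.
      by rewrite gn gtn_eqF.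
  have [_ s2] := csum_sum (index_enum 'I_n)
      (fun (j : 'I_n) g => keep (fun g => g k == j) c g * monom (xt t) g) (fun j => sp _).
  have s3 : csum (fun g => keep (fun g => g k == n) c g * monom (xt t) g) = t%:C ^+ n * A.
    rewrite -csumZ; last exact: keep_cvg xO.
    congr csum; apply/funext => g; rewrite xtE /keep.
    by case: eqP => [->|_]; rewrite ?mul0r ?mulr0// mulrCA.
  have s4 : cnorm (csum (fun g => keep (fun g => n < g k)%N c g * monom (xt t) g)) <=
      t ^+ n.+1 * M.
    apply: csum_bound; have tn0 : 0 <= t ^+ n.+1 by rewrite exprn_ge0// ltW.
    apply: bsum_le (bsumZ _ _ _ tn0 cM) => g.
    rewrite /keep; case: ifPn => ng; last first.
      by rewrite mul0r cnorm0 mulr_ge0// cnorm_ge0.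
    rewrite xtE mulrCA (cnormM (_ ^+ _)) cnormX cnorm_real gtr0_norm//.
    by apply: ler_wpM2r; [exact: cnorm_ge0|rewrite ler_wiXn2l// ltW].
  move: csplit; rewrite vc// s2 big1 ?add0r; last by move=> j _; exact: IH.
  rewrite s3 => /esym/eqP; rewrite addr_eq0 => /eqP AE.
  have := s4; rewrite -[X in X <= _]cnormN -AE cnormM cnormX cnorm_real gtr0_norm//.
  by rewrite exprSr -mulrA ler_pM2l ?exprn_gt0.
apply: cnorm_eq0; apply/eqP; rewrite eq_le cnorm_ge0 andbT.
apply/ler_addgt0Pl => e e0; rewrite addr0.
(* The shift to [M + 1] keeps the quotient meaningful when [M] is zero. *)
pose t := Num.min 1 (e / (M + 1)).
have M1 : 0 < M + 1 by lra.
have t0 : 0 < t by rewrite lt_min ltr01 divr_gt0.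
have t1 : t <= 1 by rewrite ge_min lexx.
have tM : t * (M + 1) <= e by rewrite -ler_pdivlMr// ge_min lexx orbT.
apply: le_trans (Ale t t0 t1) _; apply: le_trans tM.
by rewrite ler_pM2l//; lra.
Qed.

(** Slicing in every variable in turn leaves the single monomial [g], which is then evaluated at a
    point where it does not vanish. *)
Lemma vanishes_coef c g : abs_cvg c -> vanishes c -> c g = 0.
Proof.
move=> sc vc.
have vs (s : seq (var m)) : vanishes (keep (fun g' => all (fun k => g' k == g k) s) c).
  elim: s => [|k s IH]; first by move=> x xO; exact: vc.
  move=> x xO.
  have := vanishes_slice _ k (g k) (keep_cvg _ c sc) IH x xO.
  congr (_ = _); congr csum; apply/funext => g'.
  by rewrite /keep /=; case: eqP.
(* This point lies in [Omega] because the radius $(1-q)^{-1/2}$ is at least 1, and none of its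
   coordinates is zero. *)
pose x : Defs.cpoint R m := fun _ => (2^-1)%:C.
have h0 : (0 : R) < 2^-1 by lra.
have xO : Omega q x.
  move=> k; rewrite /x -cnormC cnorm_real gtr0_norm// ltcR.
  apply: (@lt_le_trans _ _ 1); first by lra.
  have s0 : 0 < Num.sqrt (1 - q) by rewrite sqrtr_gt0 subr_gt0.
  by rewrite invf_ge1// -[leRHS]sqrtr1 ler_sqrt// gerBl ltW.
have := vs (enum (var m)) x xO; rewrite (csum1 _ g) => [|g' g'g]; last first.
  rewrite /keep ifN ?mul0r//; apply: contra g'g => /allP h.
  by apply/eqP/ffunP => k; apply/eqP/h; rewrite mem_enum.
rewrite /keep ifT; last by apply/allP => k _.
move/eqP; rewrite mulf_eq0 => /orP[/eqP//|]; rewrite /monom => /eqP x0.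
have : \prod_k x k ^+ g k != 0.
  apply/prodf_neq0 => k _; rewrite expf_neq0// /x.
  by rewrite eq_complex /= eqxx andbT gt_eqF.
by rewrite x0 eqxx.
Qed.

Lemma fs_eval_inj (f h : fseries R m) : Hq q f -> Hq q h ->
  (forall x, Omega q x -> fs_eval f x = fs_eval h x) -> f = h.
Proof.
move=> Hf Hh fh; apply/eqP; rewrite -subr_eq0; apply/eqP.
apply/funext => g; apply/funext => S.
have Hd : Hq q (f - h) by exact: hilB (Hq_hilbert q0 q1) _ _ Hf Hh.
apply: (vanishes_coef (fun g => (f - h) g S)) => x xO.
  exact: (eval_csummable q0 q1 (f - h)).
rewrite -[LHS]/(fs_eval (f - h) x S).
rewrite addrC -scaleN1r (fs_eval_lin q0 q1)// fh// scaleN1r addrC.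
by rewrite (_ : (_ - _) S = fs_eval h x S - fs_eval h x S)// subrr.
Qed.

End IdentityTheorem.

(** * Reproducing kernels of ranges of projections *)

Section ReproducingKernels.
Context {R : realType} {m : nat} {q : R}.
Hypotheses (q0 : 0 < q) (q1 : q < 1).

(** The explicit series shows that the choice in [Ksection] is made from a nonempty set, and
    injectivity of evaluation shows that this set has only one element. *)
Lemma KsectionE y (v : ext R m) : Omega q y -> Ksection q y v = kernel_section q y v.
Proof.
move=> yO; rewrite /Ksection; set X := [set h | _].
have XK : X (kernel_section q y v).
  by split=> [|x xO]; [exact: kernel_section_Hq|exact: kernel_section_eval].
have [Hx xE] : X (xget 0 X) by apply: xgetPex; exists (kernel_section q y v).
apply: (fs_eval_inj q0 q1) => // [|x xO]; first exact: kernel_section_Hq.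
by rewrite xE// (kernel_section_eval q0 q1).
Qed.

Lemma orthproj_reproducing {V : set (fseries R m)} {P} :
  orthproj (Hq q) (inner q) V P -> is_reproducing_kernel q V (act_kernel q P).
Proof.
move=> VP; have hH := @Hq_hilbert R m q q0 q1.
have HK y (v : ext R m) : Omega q y -> Hq q (kernel_section q y v) by exact: kernel_section_Hq.
split=> [x y xO yO a u v|y v yO]; rewrite /act_kernel ?KsectionE//.
  have -> : kernel_section q y (a *: u + v) =
      a *: kernel_section q y u + kernel_section q y v.
    apply/funext => g; apply/funext => S.
    rewrite [RHS](_ : _ = a * kernel_section q y u g S + kernel_section q y v g S)//.
    by rewrite /kernel_section (_ : (a *: u + v) S = a * u S + v S)//; ring.
  have [Ku Kv] := (HK y u yO, HK y v yO).
  have [PKu PKv] := (proj_hil VP _ Ku, proj_hil VP _ Kv).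
  by rewrite (proj_linear hH VP _ _ _ Ku Kv) (fs_eval_lin q0 q1 _ _ _ _ PKu PKv xO).
exists (P (kernel_section q y v)); split => [|x xO|f Vf].
- by apply: (proj_mem VP); exact: HK.
- by [].
- have Hf := proj_sub VP _ Vf.
  by rewrite -(proj_sa hH VP) ?(proj_id hH VP)// ?kernel_section_inner//; exact: HK.
Qed.

Lemma orthproj_closed {V : set (fseries R m)} {P} :
  orthproj (Hq q) (inner q) V P -> closed_subspace q V.
Proof.
move=> VP; have hH := @Hq_hilbert R m q q0 q1; have [VH V0 VL _] := VP.
split=> // u f Vu Hf uf; apply: (proj_closed hH VP u f Vu Hf).
have Hn n : Hq q (u n - f) by apply: (hilB hH) => //; exact: VH.
rewrite (_ : (fun n => _) = fun n => hnorm q (u n - f) * hnorm q (u n - f)).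
  by rewrite -[X in _ --> X](mul0r 0); exact: cvgM.
by apply/funext => n; rewrite -expr2 sqr_sqrtr// (sqn_ge0 hH).
Qed.

Lemma orthproj_bounded {V : set (fseries R m)} {P} :
  orthproj (Hq q) (inner q) V P -> bounded_operator q P.
Proof.
move=> VP; have hH := @Hq_hilbert R m q q0 q1.
split=> [f|a f h|]; [exact: (proj_hil VP)|exact: (proj_linear hH VP)|].
exists 1 => f Hf; rewrite mul1r ler_sqrt ?(sqn_ge0 hH)//.
exact: (proj_le hH VP).
Qed.

Lemma bounded_operator_comp (S T : fseries R m -> fseries R m) :
  bounded_operator q S -> bounded_operator q T -> bounded_operator q (S \o T).
Proof.
move=> [HS LS [M MS]] [HT LT [N NT]]; split=> [f Hf|a f h Hf Hh|] /=.
- exact/HS/HT.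
- by rewrite LT// LS//; exact: HT.
(* The constant [M] carries no sign, and monotonicity needs a nonnegative factor. *)
- exists (`|M| * N) => f Hf; rewrite -mulrA.
  apply: le_trans (MS _ (HT _ Hf)) _.
  apply: (@le_trans _ _ (`|M| * hnorm q (T f))).
    by rewrite ler_wpM2r ?sqrtr_ge0// ler_norm.
  by rewrite ler_wpM2l// NT.
Qed.

Lemma bounded_operator_iter (T : fseries R m -> fseries R m) n :
  bounded_operator q T -> bounded_operator q (iter n T).
Proof.
move=> bT; elim: n => [|n IH]; last exact: bounded_operator_comp bT IH.
by split=> //; exists 1 => f _; rewrite mul1r.
Qed.

End ReproducingKernels.

Theorem theorem6p5 (R : realType) (m : nat) (q : R)
    (hm : (1 <= m)%N) (hq0 : 0 < q) (hq1 : q < 1) :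
  [/\ closed_subspace q (kerD m q),
      is_reproducing_kernel q (kerD m q) (act_kernel q (Piz q)),
      closed_subspace q (kerDdag m q),
      is_reproducing_kernel q (kerDdag m q) (act_kernel q (Piw q))
    & exists P : fseries R m -> fseries R m,
        [/\ strong_limit q (fun k => iter k (Piz q \o Piw q)) P,
            orthogonal_projection q (kerD m q `&` kerDdag m q) P
          & is_reproducing_kernel q (kerD m q `&` kerDdag m q)
              (act_kernel q P)]].
Proof.
have hH := @Hq_hilbert R m q hq0 hq1.
have hz := @Piz_orthproj R m q hq0 hq1; have hw := @Piw_orthproj R m q hq0 hq1.
split.
- exact: (orthproj_closed hq0 hq1 hz).
- exact: (orthproj_reproducing hq0 hq1 hz).
- exact: (orthproj_closed hq0 hq1 hw).
- exact: (orthproj_reproducing hq0 hq1 hw).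
have [P hP PP] := alternating_projections hH hz hw.
exists P; split; last exact: (orthproj_reproducing hq0 hq1 hP).
- split=> [n||f Hf].
  + apply: bounded_operator_iter; apply: bounded_operator_comp.
      exact: (orthproj_bounded hq0 hq1 hz).
    exact: (orthproj_bounded hq0 hq1 hw).
  + exact: (orthproj_bounded hq0 hq1 hP).
  (* The alternating projection theorem speaks of squared norms; continuity of the square root at 0
     gives convergence of [hnorm]. *)
  + rewrite -[X in _ --> X]sqrtr0; apply: (cvg_comp _ _ (PP f Hf)).
    exact: sqrt_continuous.
- split; first exact: (orthproj_closed hq0 hq1 hP).
  by have [_ _ _] := hP.
Qed.
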